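(* Let $\varepsilon>0$ be a small constant, $\alpha=\frac{\log 5}{\log 5+1-\varepsilon}$ and $\beta=\frac{\log 5-0.5\varepsilon}{\log 5+1-\varepsilon}$. Then for each large enough integer $n$, there exists an $n$-vertex graph $G=(V,E,c)$ with a terminal set $T$ of size $\frac{n}{2^{(\log n)^\alpha}}$, such that for any valid partition $\mathcal F$ of $V$ with $|\mathcal F|=O\!\left(\frac{n}{2^{(\log n)^\beta}}\right)$, there exists a demand $\mathcal D$ on the terminals with $\mathrm{cong}_G(\mathcal D)=\Omega\big((\log n)^{1-\alpha}\big)$ and $\mathrm{cong}_H(\mathcal D)=O(1)$, where $H$ is the contracted graph of $G$ with respect to $\mathcal F$.
   Context: All logarithms are base 2. Graphs are undirected with edge capacities $c(e)\ge 1$. A partition $\mathcal F$ of $V$ is valid if the terminals of $T$ lie in distinct parts. The contracted graph $H$ of $G$ with respect to $\mathcal F$ has one node per part of $\mathcal F$; for each edge $(u,v)$ of $G$ with $u,v$ in different parts there is an edge of the same capacity between their parts (parallel edges kept, self-loops removed); terminals are identified with the nodes containing them. A demand $\mathcal D$ on $T$ assigns $\mathcal D_{t,t'}\ge 0$ (not all zero) to each unordered terminal pair; a flow routes $\mathcal D$ if it sends $\mathcal D_{t,t'}$ units between $t,t'$; the congestion of a flow is $\max_e(\text{flow on }e)/c(e)$ and $\mathrm{cong}_G(\mathcal D)$ is the minimum congestion over flows routing $\mathcal D$ in $G$ (similarly for $H$). Asymptotic notation refers to $n\to\infty$ with constants independent of $n$. *)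

(* Defs.v *)
From HB Require Import structures.
From mathcomp Require Import all_boot all_order all_algebra.
From mathcomp Require Import all_classical all_reals all_analysis.
Set Implicit Arguments. Unset Strict Implicit. Unset Printing Implicit Defensive.
Import Order.TTheory GRing.Theory Num.Theory.
Local Open Scope ring_scope.
Local Open Scope classical_set_scope.

Section Flows.
Variable R : realType.

Definition log2 (x : R) : R := ln x / ln 2.

(* An (undirected multi)graph on vertex type W, with edges indexed by E:
   ends e = the two endpoints of e, cap e = capacity c(e).  A flow of
   commodity k is a signed value g e on every edge (positive = from
   (ends e).1 to (ends e).2). *)
Definition netflow (W E : finType) (ends : E -> W * W) (g : E -> R) (v : W) : R :=
  \sum_(e | (ends e).1 == v) g e - \sum_(e | (ends e).2 == v) g e.

Definition routes (W E K : finType) (ends : E -> W * W)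
  (src snk : K -> W) (d : K -> R) (f : K -> E -> R) : Prop :=
  forall k v, netflow ends (f k) v
              = d k * ((v == src k)%:R - (v == snk k)%:R).

Definition congestion (E K : finType) (cap : E -> R) (f : K -> E -> R) : R :=
  \big[Num.max/0]_(e : E) ((\sum_(k : K) `|f k e|) / cap e).

(* minimum congestion over all flows routing the demand
   (+oo if no routing flow exists) *)
Definition cong (W E K : finType) (ends : E -> W * W) (cap : E -> R)
  (src snk : K -> W) (d : K -> R) : \bar R :=
  ereal_inf [set (congestion cap f)%:E | f in [set f | routes ends src snk d f]].

(* Demands on a terminal set T of 'I_n: an unordered pair {t,t'} is
   represented by the ordered pair (t,t') with t < t'; D t t' is its demand. *)
Definition is_demand (n : nat) (T : {set 'I_n}) (D : 'I_n -> 'I_n -> R) : Prop :=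
  (forall t t', 0 <= D t t') /\
  exists t t', [/\ t \in T, t' \in T, (t < t')%N & D t t' != 0].

Definition dem (n : nat) (T : {set 'I_n}) (D : 'I_n -> 'I_n -> R)
  (k : 'I_n * 'I_n) : R :=
  if [&& k.1 \in T, k.2 \in T & (k.1 < k.2)%N] then D k.1 k.2 else 0.

Definition congG (n m : nat) (ends : 'I_m -> 'I_n * 'I_n) (cap : 'I_m -> R)
  (T : {set 'I_n}) (D : 'I_n -> 'I_n -> R) : \bar R :=
  cong ends cap (fun k : 'I_n * 'I_n => k.1) (fun k => k.2) (dem T D).

Definition valid_partition (n : nat) (P : {set {set 'I_n}}) (T : {set 'I_n}) : Prop :=
  finset.partition P [set: 'I_n] /\
  {in T &, forall t t', finset.pblock P t = finset.pblock P t' -> t = t'}.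

(* Contracted graph H: nodes are the parts (blocks of P, as sets of
   vertices); edges are the edges of G whose ends lie in different parts
   (self-loops removed, parallel edges kept), with the same capacity. *)
Definition crossing (n m : nat) (ends : 'I_m -> 'I_n * 'I_n)
  (P : {set {set 'I_n}}) (e : 'I_m) : bool :=
  finset.pblock P (ends e).1 != finset.pblock P (ends e).2.

Definition congH (n m : nat) (ends : 'I_m -> 'I_n * 'I_n) (cap : 'I_m -> R)
  (P : {set {set 'I_n}}) (T : {set 'I_n}) (D : 'I_n -> 'I_n -> R) : \bar R :=
  cong (E := {e : 'I_m | crossing ends P e})
    (fun e => (finset.pblock P (ends (val e)).1, finset.pblock P (ends (val e)).2))
    (fun e => cap (val e))
    (fun k : 'I_n * 'I_n => finset.pblock P k.1) (fun k => finset.pblock P k.2) (dem T D).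

Definition alpha (eps : R) : R := log2 5 / (log2 5 + 1 - eps).
Definition beta (eps : R) : R := (log2 5 - eps / 2) / (log2 5 + 1 - eps).

End Flows.

(* Main.v *)
(* The base graph is a union of partial matchings, one per colour, that is nearly
   regular of degree d and has girth of order log_d n.  Every base vertex is joined to a terminal
   whose centre lies within distance 2 rho, where log (n/|T|) is of order rho log d and d of order rho.  Inside a
   part of the given partition, H allows free jumps, and since the parts are large on average most
   vertices can be matched inside their part so that each jump covers a large distance.  If many
   jumps already reach distance M of order log_d n, route along them.  Otherwise alternate such
   jumps with rho edges of distinct colours: for most starting points no backtracking occurs,
   because at each vertex only one colour in d leads back, so by the girth the distances add up
   to M.  For a fixed colour sequence the walks are bijections of the base vertices, so sending one
   unit along each of them uses every edge of H at most twice; in G, the total length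
   of edges is of order rho per vertex, whereas the demands are at distance M, so the congestion
   is of order M / rho, that is log n / log (n/|T|). *)
Require Import Defs.
From HB Require Import structures.
From mathcomp Require Import all_boot all_order all_algebra fingroup perm.
From mathcomp Require Import all_classical all_reals all_analysis.
From mathcomp Require Import zify ring lra.
Import Order.TTheory GRing.Theory Num.Theory.
Local Open Scope ring_scope.
Set Implicit Arguments. Unset Strict Implicit. Unset Printing Implicit Defensive.

(** * Walks in graphs coloured by involutions *)
Section Walks.
Local Open Scope nat_scope.
Variables (V C : finType) (p : C -> {perm V}).

Definition walk (x : V) (w : seq C) : V := foldl (fun y c => p c y) x w.

(** A fixed point of [p c] is a vertex at which the colour [c] is missing, so a moving word
    traverses a genuine edge at every step. *)
Fixpoint moving (x : V) (w : seq C) : bool :=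
  if w is c :: w' then (p c x != x) && moving (p c x) w' else true.

(** Each colour class is a partial matching, so going back along the last edge means repeating its
    colour; distinct consecutive colours thus express non-backtracking. *)
Definition nbwalk (x : V) (w : seq C) : bool :=
  sorted (fun a b => a != b) w && moving x w.

Definition girth_gt (g : nat) : Prop :=
  forall x w, w != [::] -> size w <= g -> nbwalk x w -> walk x w != x.

Definition stay_or_step (oy : option C * V) : V :=
  if oy.1 is Some c then p c oy.2 else oy.2.

Fixpoint cball (m : nat) (x : V) : {set V} :=
  if m is m'.+1 then stay_or_step @: finset.setX [set: option C] (cball m' x)
  else [set x].

(* The distance truncated at [N]; in particular it is [N] across different components. *)
Definition tdist (N : nat) (x y : V) : nat :=
  find (fun m => y \in cball m x) (iota 0 N).

Definition toward (N : nat) (x u : V) (c : C) : bool :=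
  tdist N x (p c u) < tdist N x u.

Hypothesis pK : forall c, involutive (p c).

Lemma walk_cat x u v : walk x (u ++ v) = walk (walk x u) v.
Proof. exact: foldl_cat. Qed.

Lemma walk_rcons x u c : walk x (rcons u c) = p c (walk x u).
Proof. by rewrite -cats1 walk_cat. Qed.

Lemma walk_rev x w : walk (walk x w) (rev w) = x.
Proof.
elim: w x => [|c w IH] x //=.
by rewrite rev_cons walk_rcons IH pK.
Qed.

Lemma moving_cat x u v : moving x (u ++ v) = moving x u && moving (walk x u) v.
Proof. by elim: u x => [|c u IH] x //=; rewrite IH andbA. Qed.

Lemma moving_rev x w : moving x w -> moving (walk x w) (rev w).
Proof.
elim: w x => [|c w IH] x //= /andP[cx mw].
by rewrite rev_cons -cats1 moving_cat IH //= walk_rev pK eq_sym cx.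
Qed.

Lemma sorted_rcons_cat (T : Type) (r : rel T) s a t :
  sorted r (rcons s a ++ t) = sorted r (rcons s a) && path r a t.
Proof. by case: s => [|b s] //=; rewrite cat_path last_rcons. Qed.

Lemma nbwalk_cons x c w : nbwalk x (c :: w) -> nbwalk (p c x) w.
Proof. by rewrite /nbwalk /= => /andP[/path_sorted -> /andP[]]. Qed.

Lemma nbwalk_rcons x w c : nbwalk x (rcons w c) -> nbwalk x w.
Proof.
rewrite /nbwalk -cats1 moving_cat => /andP[sw /andP[-> _]].
rewrite andbT; move: sw; case: w => [|b w] //=.
by rewrite cat_path => /andP[].
Qed.

(** After cancelling a common prefix, the reversal of [u] followed by [v] would be a closed
    non-backtracking walk of length at most [g]. *)
Lemma nbwalk_uniq g x u v : girth_gt g -> nbwalk x u -> nbwalk x v ->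
  walk x u = walk x v -> size u + size v <= g -> u = v.
Proof.
move=> gg; elim: u x v => [|c u IH] x [|c' v] // nu nv.
- by move=> /= e sz; have := gg x (c' :: v) isT sz nv; rewrite /= -e eqxx.
- move=> e sz; have := gg x (c :: u) isT; rewrite addn0 in sz.
  by move=> /(_ sz nu); rewrite e eqxx.
case: (eqVneq c c') nv => [<-|neq] nv.
  move=> e sz; congr (_ :: _); apply: (IH (p c x)) => //.
  - exact: nbwalk_cons nu.
  - exact: nbwalk_cons nv.
  - by move: sz => /=; lia.
move=> e sz; have [su mu] := andP nu; have [sv mv] := andP nv.
have nb : nbwalk (walk x (c :: u)) (rev (c :: u) ++ c' :: v).
  rewrite /nbwalk moving_cat moving_rev // walk_rev mv andbT.
  rewrite rev_cons sorted_rcons_cat /= neq -rev_cons rev_sorted.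
  rewrite (eq_sorted (e' := fun a b => a != b)) => [|a b]; last by rewrite eq_sym.
  by rewrite su /= andbT.
have ne : rev (c :: u) ++ c' :: v != [::] by case: (rev _).
have sz' : size (rev (c :: u) ++ c' :: v) <= g by rewrite size_cat size_rev.
by have := gg _ _ ne sz' nb; rewrite walk_cat walk_rev -e eqxx.
Qed.

Lemma cballS m x y : reflect (y \in cball m x \/ exists c, p c y \in cball m x)
  (y \in cball m.+1 x).
Proof.
apply: (iffP imsetP) => [[[[c|] z]]|[yb|[c yb]]].
- by rewrite finset.in_setX => /andP[_ zb] ->; right; exists c => //=; rewrite pK.
- by rewrite finset.in_setX => /andP[_ zb] ->; left.
- by exists (None, y) => //; rewrite finset.in_setX finset.in_setT.
- by exists (Some c, p c y); rewrite ?finset.in_setX ?finset.in_setT //= /stay_or_step /= pK.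
Qed.

Lemma cball_mono m k x : m <= k -> cball m x \subset cball k x.
Proof.
move=> /subnK <-; elim: (k - m) => [|j IH] //=.
apply: (fintype.subset_trans IH); apply/fintype.subsetP => y yb.
by apply/cballS; left.
Qed.

Lemma mem_cball_walk m x w : size w <= m -> walk x w \in cball m x.
Proof.
elim/last_ind: w m => [|w c IH] m.
  by move=> _; apply: (fintype.subsetP (cball_mono x (leq0n m))); rewrite inE.
rewrite size_rcons walk_rcons; case: m => // m sz.
by apply/cballS; right; exists c; rewrite pK IH.
Qed.

(** A walk is shortened rather than extended when the new colour repeats the last one, and left
    alone when the new colour is missing. *)
Lemma cball_walk m x y : y \in cball m x ->
  exists w, [/\ size w <= m, nbwalk x w & walk x w = y].
Proof.
elim: m y => [|m IH] y; first by rewrite inE => /eqP ->; exists [::].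
case/cballS => [/IH[w [sz nb e]]|[c /IH[w [sz nb e]]]].
  by exists w; split=> //; apply: leqW.
have [yE|yE] := eqVneq (p c y) y.
  by exists w; split=> //; [exact: leqW | rewrite e].
case/lastP: w sz nb e => [|w b] sz nb e.
  exists [:: c]; rewrite /nbwalk /= (e : x = p c y) pK.
  by split=> //; rewrite eq_sym yE.
have [bc|bc] := eqVneq b c.
  exists w; split; first by move: sz; rewrite size_rcons; lia.
    exact: nbwalk_rcons nb.
  by move: e; rewrite walk_rcons bc => /perm_inj.
exists (rcons (rcons w b) c); split; first by rewrite size_rcons.
  move: nb; rewrite /nbwalk => /andP[sw mw].
  rewrite -[rcons (rcons w b) c]cats1 sorted_rcons_cat moving_cat sw mw e /=.
  by rewrite bc pK eq_sym yE.
by rewrite walk_rcons e pK.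
Qed.

Lemma cball_sym m x y : (y \in cball m x) = (x \in cball m y).
Proof.
by apply/idP/idP => /cball_walk[w [sz _ <-]];
  rewrite -[X in X \in _](walk_rev _ w) mem_cball_walk ?size_rev.
Qed.

Lemma cball_trans m k x y z : y \in cball m x -> z \in cball k y -> z \in cball (m + k) x.
Proof.
move=> /cball_walk[w [sz _ <-]] /cball_walk[w' [sz' _ <-]].
by rewrite -walk_cat mem_cball_walk // size_cat leq_add.
Qed.

Lemma card_cball m x : #|cball m x| <= #|C|.+1 ^ m.
Proof.
elim: m => [|m IH]; first by rewrite cards1.
apply: leq_trans (leq_imset_card _ _) _.
by rewrite cardsX cardsT card_option expnS leq_mul2l IH.
Qed.

Lemma tdist_leN N x y : tdist N x y <= N.
Proof. by rewrite /tdist -{2}(size_iota 0 N) find_size. Qed.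

Lemma tdist_le N x y m : (tdist N x y <= m) = (N <= m) || (y \in cball m x).
Proof.
have [Nm|mN] /= := leqP N m; first by rewrite (leq_trans (tdist_leN _ _ _)).
apply/idP/idP => [tm|ym].
  have : has (fun k => y \in cball k x) (iota 0 N).
    by rewrite has_find size_iota (leq_ltn_trans tm).
  move=> /(nth_find 0); rewrite -/(tdist N x y) nth_iota ?(leq_ltn_trans tm) //.
  exact/fintype.subsetP/cball_mono.
rewrite leqNgt; apply/negP => /(before_find 0).
by rewrite nth_iota // add0n ym.
Qed.

Lemma tdistxx N x : tdist N x x = 0.
Proof. by apply/eqP; rewrite -leqn0 tdist_le inE eqxx orbT. Qed.

Lemma tdist_sym N x y : tdist N x y = tdist N y x.
Proof.
have le a b : tdist N a b <= tdist N b a by rewrite tdist_le cball_sym -tdist_le.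
by apply/eqP; rewrite eqn_leq !le.
Qed.

Lemma tdist_triangle N x y z : tdist N x z <= tdist N x y + tdist N y z.
Proof.
rewrite tdist_le; case: leqP => //= ltN.
have := leqnn (tdist N x y); have := leqnn (tdist N y z); rewrite !tdist_le.
case: leqP => [|_ /= bz]; first by have := tdist_leN N x y; lia.
case: leqP => [|_ /= bx]; first by have := tdist_leN N y z; lia.
exact: cball_trans bx bz.
Qed.

Lemma tdist_step N x c : tdist N x (p c x) <= 1.
Proof. by rewrite tdist_le (@mem_cball_walk 1 x [:: c]) ?orbT. Qed.

Lemma tdist_walk N x w : tdist N x (walk x w) <= size w.
Proof. by rewrite tdist_le mem_cball_walk ?orbT. Qed.

Lemma tdist_geodesic N x y : tdist N x y < N ->
  exists w, [/\ size w = tdist N x y, nbwalk x w & walk x w = y].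
Proof.
move=> ltN; have := leqnn (tdist N x y); rewrite tdist_le leqNgt ltN /=.
move=> /cball_walk[w [sz nb e]]; exists w; split=> //.
by apply/eqP; rewrite eqn_leq sz -{1}e tdist_walk.
Qed.

(** A geodesic to [p c u] cannot end with [c], since it would then visit [u] earlier; appending [c]
    therefore does not backtrack. *)
Lemma toward_walk N x u c : toward N x u c ->
  exists w, [/\ size w < N, nbwalk x (rcons w c) & walk x (rcons w c) = u].
Proof.
move=> lt; have ltN : tdist N x (p c u) < N by exact: leq_trans (tdist_leN N x u).
have [w [sz nb e]] := tdist_geodesic ltN.
exists w; rewrite sz walk_rcons e pK; split=> //.
have uc : p c u != u by apply: contraTneq lt => e'; rewrite /toward e' ltnn.
case/lastP: w sz nb e => [|w b] sz nb e.
  by rewrite /nbwalk /= (e : x = p c u) pK eq_sym uc.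
rewrite /nbwalk -cats1 sorted_rcons_cat moving_cat e /= pK [u == _]eq_sym uc.
case/andP: nb => -> ->; rewrite /= !andbT.
apply: contraTneq lt => bc; rewrite /toward -leqNgt -sz size_rcons.
move: e; rewrite walk_rcons bc => /perm_inj <-.
exact: leq_trans (tdist_walk _ _ _) (leqnSn _).
Qed.

(** * Tree-like behaviour of the distance below a third of the girth *)

Section Girth.
Variables (g N : nat).
Hypotheses (gg : girth_gt g) (gN : 3 * N <= g).

(** Two such colours would end two different non-backtracking walks from [x] to [u], of total length
    at most [2 * N]. *)
Lemma toward_inj x u c c' : toward N x u c -> toward N x u c' -> c = c'.
Proof.
move=> /toward_walk[w [sz nb e]] /toward_walk[w' [sz' nb' e']].
have /rcons_inj[] // : rcons w c = rcons w' c'.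
apply: (nbwalk_uniq gg nb nb'); rewrite ?e ?e' // !size_rcons; lia.
Qed.

(** An edge joining two vertices at equal distance from [x] would yield two non-backtracking walks
    to [p c u] whose lengths differ by one, against the girth. *)
Lemma tdist_away x u c : tdist N x u < N -> p c u != u -> ~~ toward N x u c ->
  tdist N x (p c u) = (tdist N x u).+1.
Proof.
move=> ltN uc; rewrite /toward -leqNgt => le.
apply/eqP; rewrite eqn_leq.
rewrite (leq_trans (tdist_triangle N x u _)) /=; last first.
  by rewrite -addn1 leq_add2l tdist_step.
rewrite ltn_neqAle le andbT; apply/eqP => eqd.
have [w [sz nb e]] := tdist_geodesic ltN.
have ltN' : tdist N x (p c u) < N by rewrite -eqd.
have [w' [sz' nb' e']] := tdist_geodesic ltN'.
have nbc : nbwalk x (rcons w c).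
  case/lastP: w sz nb e => [|w b] sz nb e; first by move: e => /= ->; rewrite /nbwalk /= uc.
  rewrite /nbwalk -cats1 sorted_rcons_cat moving_cat e /= uc.
  case/andP: nb => -> ->; rewrite /= !andbT.
  apply/eqP => bc; move: e; rewrite walk_rcons bc => e.
  have : tdist N x (p c u) <= size w by rewrite -e pK tdist_walk.
  by rewrite -eqd -sz size_rcons ltnn.
have := nbwalk_uniq gg nbc nb'; rewrite walk_rcons e e' size_rcons sz sz' eqd.
by move=> /(_ erefl _)/(congr1 size); rewrite size_rcons sz sz' eqd; lia.
Qed.

(** The geodesic from [v] to [v'] does not begin with [c], so it extends the walk from [x] to [v]
    without backtracking. A shorter way to [v'] would be a second such walk; three pieces of length
    at most [N] are involved, whence [3 * N <= g]. *)
Lemma tdist_jump x v v' c : toward N x v c -> tdist N v v' < N ->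
  ~~ toward N v' v c -> minn N (tdist N x v + tdist N v v') <= tdist N x v'.
Proof.
move=> /toward_walk[w [sz nb e]] ltN away.
have [w' [sz' nb' e']] := tdist_geodesic ltN.
have nbc : nbwalk x (rcons w c ++ w').
  rewrite /nbwalk sorted_rcons_cat moving_cat e.
  case/andP: nb => -> ->; case/andP: nb' => sw' mw'; rewrite mw' !andbT /=.
  case: w' sz' e' sw' mw' => //= b w' sz' e' -> _; rewrite andbT.
  apply: contraNneq away => cb; rewrite /toward ![tdist N v' _]tdist_sym -sz' cb.
  by rewrite ltnS -e' tdist_walk.
rewrite leqNgt leq_min; apply/negP => /andP[ltN' lt].
have [w'' [sz'' nb'' e'']] := tdist_geodesic ltN'.
have := nbwalk_uniq gg nbc nb''.
rewrite walk_cat e e' e'' size_cat size_rcons sz' sz'' => /(_ erefl).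
have dv : tdist N x v <= (size w).+1 by rewrite -e -(size_rcons w c) tdist_walk.
by move=> h; have := congr1 size (h _); rewrite size_cat size_rcons sz' sz''; lia.
Qed.
End Girth.
End Walks.

(** * Inserting one edge between far apart vertices preserves the girth *)

Section AddEdge.
Local Open Scope nat_scope.
Variables (V C : finType) (q : {ffun C -> {perm V}}) (c0 : C) (x y : V).
Hypotheses (qK : forall c, involutive (q c)).
Hypotheses (qx : q c0 x = x) (qy : q c0 y = y) (xy : x != y).

(** Both [x] and [y] miss the colour [c0], so composing with the transposition inserts exactly the
    edge between them in that colour. *)
Definition add_edge : {ffun C -> {perm V}} :=
  [ffun c => if c == c0 then (q c * tperm x y)%g else q c].

Lemma add_edgeE c z : add_edge c z =
  if (c == c0) && (z == x) then y else if (c == c0) && (z == y) then x else q c z.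
Proof.
rewrite /add_edge ffunE; case: eqVneq => [->|] //=; rewrite permM.
case: eqVneq => [->|zx]; first by rewrite qx tpermL.
case: eqVneq => [->|zy]; first by rewrite qy tpermR.
by rewrite tpermD // eq_sym -1?qx -1?qy (inj_eq perm_inj).
Qed.

Lemma add_edgeK c : involutive (add_edge c).
Proof.
move=> z; rewrite !add_edgeE; case: (eqVneq c c0) => [->|] /=; last by rewrite qK.
case: (eqVneq z x) => [->|zx]; first by rewrite eqxx (negbTE (_ : y != x)) // eq_sym.
case: (eqVneq z y) => [->|zy]; first by rewrite eqxx.
rewrite -{1}qx (inj_eq perm_inj) (negbTE zx).
by rewrite -{1}qy (inj_eq perm_inj) (negbTE zy) qK.
Qed.

(** The walk is cut at its first use of the new edge, crossed from [a] to [b]. *)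
Lemma add_edge_walk z w : moving add_edge z w ->
  (walk add_edge z w = walk q z w /\ moving q z w) \/
  exists w1 w2 a b, [/\ w = w1 ++ c0 :: w2, (a, b) = (x, y) \/ (a, b) = (y, x),
    walk q z w1 = a, moving q z w1 &
    walk add_edge b w2 = walk add_edge z w /\ moving add_edge b w2].
Proof.
elim: w z => [|c w IH] z; first by left.
have [|old] := boolP ((c == c0) && ((z == x) || (z == y))).
  move=> /andP[/eqP-> zxy] /andP[_ mw]; right.
  exists [::], w, z, (add_edge c0 z); split=> //; rewrite add_edgeE eqxx /=.
  by case/orP: zxy => /eqP->; rewrite eqxx ?(negbTE xy) 1?eq_sym ?(negbTE xy);
    [left|right].
have cz : add_edge c z = q c z.
  by rewrite add_edgeE; move: old; do 3!case: eqVneq => ? //=.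
rewrite /= cz => /andP[mc /IH[[-> mw]|[w1 [w2 [a [b [-> ab wa ma mw]]]]]]].
  by left; rewrite mc.
by right; exists (c :: w1), w2, a, b; split=> //=; rewrite mc.
Qed.

(** A short closed walk must use the new edge. If it does so once, the rest joins [x] and [y] by old
    edges, although they are far apart. If more often, the piece [w3] between the first two uses
    either joins [x] and [y] as well, or is a closed walk of old edges; it is nonempty because [c0]
    is not repeated at once. *)
Lemma add_edge_girth g : girth_gt q g -> y \notin cball q g x -> girth_gt add_edge g.
Proof.
move=> gq far.
have farab a b u : (a, b) = (x, y) \/ (a, b) = (y, x) -> size u <= g ->
    walk q b u = a -> False.
  move=> ab sz ua; move: far; have : a \in cball q g b by rewrite -ua mem_cball_walk.
  by case: ab => -[-> ->]; rewrite ?[x \in _](cball_sym qK) => ->.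
move=> z w wn0 sz /andP[sw mw]; apply/eqP => closed.
case: (add_edge_walk mw) => [[e m]|].
  by have := gq z w wn0 sz; rewrite /nbwalk sw m -e closed eqxx => /(_ isT).
move=> [w1 [w2 [a [b [ew ab wa ma [e mw2]]]]]].
move: sz sw; rewrite ew size_cat /= => sz sw.
case: (add_edge_walk mw2) => [[e2 m2]|].
  apply: (farab a b (w2 ++ w1) ab); first by rewrite size_cat; lia.
  by rewrite walk_cat -e2 e closed.
move=> [w3 [w4 [a' [b' [ew2 ab' wa' ma' _]]]]].
move: sz; rewrite ew2 size_cat /= => sz.
have [aa|ba] : a' = a \/ a' = b.
- by case: ab ab' => -[-> ->] [] [-> _]; [left|right|right|left].
- by apply: (farab a b w3 ab); [lia | rewrite wa' aa].
have s3 : sorted (fun a b => a != b) (c0 :: w3 ++ c0 :: w4).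
  by move: sw; rewrite ew2 -cat_rcons sorted_rcons_cat => /andP[].
have n3 : w3 != [::] by case: (w3) s3 => //=; rewrite eqxx.
have sz3 : size w3 <= g by lia.
have /(_ _)/negP := gq b w3 n3 sz3; rewrite wa' ba eqxx; apply=> //.
rewrite /nbwalk ma' andbT; move: s3 => /= /path_sorted.
by case: (w3) => //= d u; rewrite cat_path => /andP[].
Qed.
End AddEdge.

(* Greedy construction: as long as two far apart vertices miss the same colour, they can be
   joined; so the vertices missing a given colour all lie in one small ball. *)
Lemma exists_girth_gt (V C : finType) (g : nat) : exists p : C -> {perm V},
  [/\ forall c, involutive (p c), girth_gt p g
    & forall c, (#|[set x | p c x == x]| <= #|C|.+1 ^ g)%N].
Proof.
pose P (q : {ffun C -> {perm V}}) := `[< (forall c, involutive (q c)) /\ girth_gt q g >].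
have P1 : P [ffun=> 1%g].
  apply/asboolP; split=> [c x|x w]; first by rewrite !ffunE !perm1.
  by case: w => // c w _ _; rewrite /nbwalk /= ffunE perm1 eqxx andbF.
case: (@arg_maxnP _ [ffun=> 1%g] P (fun q => \sum_c #|[set x | q c x != x]|)%N P1).
move=> q /asboolP[qK gq] qmax; exists q; split=> // c.
have [->|[x xU]] := finset.set_0Vmem [set x | q c x == x]; first by rewrite cards0.
apply: leq_trans (card_cball q g x).
apply: subset_leq_card; apply/fintype.subsetP => y; rewrite !inE in xU *.
move/eqP: xU => qx /eqP qy; rewrite -[_ \in _]negbK; apply/negP => far.
have xy : x != y.
  apply: contraNneq far => <-; exact: (fintype.subsetP (cball_mono qK _ (leq0n g))) (set11 x).
have : P (add_edge q c x y).
  apply/asboolP; split; first exact: add_edgeK.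
  exact: add_edge_girth.
move=> /qmax; apply/negP; rewrite -ltnNge.
rewrite (bigD1 c) //= [X in (_ < X)%N](bigD1 c) //= -addSn leq_add //; last first.
  rewrite leq_eqVlt; apply/orP; left; apply/eqP; apply: eq_bigr => c' cc'.
  by apply: eq_card => z; rewrite !inE add_edgeE // (negbTE cc').
apply: proper_card; apply/properP; split.
  apply/fintype.subsetP => z; rewrite !inE add_edgeE // eqxx /=.
  case: (eqVneq z x) => [->|_]; first by rewrite qx eqxx.
  by case: (eqVneq z y) => [->|_]; first by rewrite qy eqxx.
by exists x; rewrite !inE ?qx ?eqxx // add_edgeE // !eqxx eq_sym.
Qed.

(** * Few centres within distance [2 * rho] of every vertex *)

Section Covering.
Local Open Scope nat_scope.
Variables (V : finType) (h rho g : nat) (p : bool * 'I_h -> {perm V}).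
Hypotheses (pK : forall c, involutive (p c)) (gg : girth_gt p g) (rg : 2 * rho <= g).

Let stuck := [set x | [exists c, p c x == x]].

(* Alternating the first component makes every such colour word non-backtracking. *)
Fixpoint alternate (b : bool) (s : seq 'I_h) : seq (bool * 'I_h) :=
  if s is i :: s' then (b, i) :: alternate (~~ b) s' else [::].

Lemma size_alternate b s : size (alternate b s) = size s.
Proof. by elim: s b => //= i s IH b; rewrite IH. Qed.

Lemma alternate_inj b : injective (alternate b).
Proof.
by move=> s t; elim: s t b => [|i s IH] [|j t] b //= [-> /IH->].
Qed.

Lemma sorted_alternate b s : sorted (fun a b => a != b) (alternate b s).
Proof.
case: s => //= i s; elim: s b i => //= j s IH b i.
by rewrite IH andbT xpair_eqE; case: b.
Qed.

Lemma moving_unstuck m x w : size w <= m ->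
  [disjoint cball p m x & stuck] -> moving p x w.
Proof.
elim: m x w => [|m IH] x [|c w] //= sz dis.
have xm : x \in cball p m.+1 x.
  by rewrite (fintype.subsetP (cball_mono pK _ (leq0n m.+1))) // inE.
have := disjointFr dis xm; rewrite inE => /existsPn/(_ c) ->.
apply: IH => //; apply: disjointWl dis; apply/fintype.subsetP => y yb.
by apply: (@cball_trans _ _ _ pK 1 m _ _ _ _ yb); apply: (@mem_cball_walk _ _ p pK 1 x [:: c]).
Qed.

(** With no stuck vertex nearby every alternating word moves, and two different words of length
    [rho] end at different vertices because their total length is at most [g]. *)
Lemma cball_large x : [disjoint cball p rho x & stuck] -> h ^ rho <= #|cball p rho x|.
Proof.
move=> dis.
have nb (t : rho.-tuple 'I_h) : nbwalk p x (alternate true t).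
  rewrite /nbwalk sorted_alternate (moving_unstuck _ dis) //.
  by rewrite size_alternate size_tuple.
pose f (t : rho.-tuple 'I_h) := walk p x (alternate true t).
have f_inj : injective f.
  move=> t u e; apply/val_inj/(@alternate_inj true).
  by apply: (nbwalk_uniq pK gg (nb t) (nb u) e); rewrite !size_alternate !size_tuple; lia.
rewrite -{1}(card_ord h) -card_tuple -(card_imset _ f_inj).
apply: subset_leq_card; apply/fintype.subsetP => _ /imsetP[t _ ->].
by rewrite mem_cball_walk // size_alternate size_tuple.
Qed.

(** [Z] is a maximal set with pairwise distances above [2 * rho]; maximality makes it a covering.
    The balls of radius [rho] around it are disjoint, and each one contains [h ^ rho] vertices or a
    stuck vertex. *)
Lemma exists_centers : exists (Z : {set V}) (z : V -> V),
  [/\ forall x, z x \in Z, forall x, z x \in cball p (2 * rho) x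
    & #|Z| * h ^ rho <= #|V| + h ^ rho * #|stuck|].
Proof.
pose P (Z : {set V}) :=
  [forall x in Z, forall y in Z, (x != y) ==> (y \notin cball p (2 * rho) x)].
have [|Z /maxsetP[PZ Zmax]] := @ex_maxset _ P.
  by exists finset.set0; apply/forall_inP => x; rewrite inE.
have sep x y : x \in Z -> y \in Z -> y \in cball p (2 * rho) x -> x = y.
  move=> xZ yZ yb; have /forall_inP/(_ x xZ)/forall_inP/(_ y yZ) := PZ.
  by rewrite yb implybF negbK => /eqP.
have cov x : exists z, (z \in Z) && (z \in cball p (2 * rho) x).
  have self y : y \in cball p (2 * rho) y.
    by rewrite (fintype.subsetP (cball_mono pK _ (leq0n _))) // inE.
  have [xZ|xZ] := boolP (x \in Z); first by exists x; rewrite xZ self.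
  apply/existsP; apply: contraNT xZ => /existsPn none.
  rewrite -(Zmax (x |: Z)) ?setU11 ?finset.subsetUr //.
  have far z : z \in Z -> z \notin cball p (2 * rho) x.
    by move=> zZ; move: (none z); rewrite zZ.
  apply/forall_inP => a; rewrite !inE => /orP[/eqP->|aZ]; apply/forall_inP => b.
    rewrite !inE => /orP[/eqP->|bZ]; first by rewrite eqxx.
    by rewrite far ?implybT.
  rewrite !inE => /orP[/eqP->|bZ].
    by rewrite cball_sym // far ?implybT.
  by apply/implyP => ab; apply: contra ab => /(sep _ _ aZ bZ) ->.
exists Z, (fun x => xchoose (cov x)).
split=> [x|x|]; [by case/andP: (xchooseP (cov x)) .. |].
have packing (A : {set V}) : \sum_(z in Z) #|cball p rho z :&: A| <= #|A|.
  have cardE z : #|cball p rho z :&: A| = \sum_(x in A) (x \in cball p rho z).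
    rewrite -sum1_card big_mkcond [RHS]big_mkcond; apply: eq_bigr => x _.
    by rewrite inE; do 2!case: (x \in _).
  under eq_bigr do rewrite cardE.
  rewrite exchange_big -sum1_card leq_sum // => x _ /=.
  have [|none] := boolP [exists z in Z, x \in cball p rho z]; last first.
    rewrite big1 // => z zZ; case: (boolP (x \in _)) => // xb.
    by case/existsP: none; exists z; rewrite zZ.
  case/existsP => z /andP[zZ xz]; rewrite (bigD1 z) //= xz.
  rewrite big1 ?addn0 // => z' /andP[zZ' /eqP ne]; case: (boolP (x \in _)) => // xz'.
  by case: ne; apply: sep => //; rewrite mul2n -addnn (cball_trans pK xz') // -cball_sym.
rewrite -sum_nat_const.
have le1 z : z \in Z ->
    h ^ rho <= #|cball p rho z :&: [set: V]| + h ^ rho * #|cball p rho z :&: stuck|.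
  move=> _; rewrite finset.setIT; have [dis|/pred0Pn[y]] := boolP [disjoint cball p rho z & stuck].
    by rewrite (leq_trans (cball_large dis)) ?leq_addr.
  rewrite /= => /andP[yb yS]; apply: leq_trans (leq_addl _ _).
  by rewrite leq_pmulr //; apply/card_gt0P; exists y; rewrite inE yb.
apply: (@leq_trans (\sum_(z in Z)
    (#|cball p rho z :&: [set: V]| + h ^ rho * #|cball p rho z :&: stuck|))).
  exact: leq_sum.
rewrite big_split -big_distrr /= leq_add ?leq_mul2l ?packing ?orbT //.
by rewrite -cardsT packing.
Qed.
End Covering.

(** * Matching far apart vertices inside the parts *)

Section Matching.
Local Open Scope nat_scope.
Variables (V Q : finType) (F : V -> Q) (far : rel V) (B : nat).
Hypotheses (farC : symmetric far) (farxx : irreflexive far).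
Hypothesis (nearB : forall x, #|[set y | ~~ far x y]| <= B).

(** In an involution moving as many vertices as possible, two unmatched vertices of one part cannot
    be far from each other; so those of a part all lie in the near set of any one of them. *)
Lemma exists_far_matching : exists s : {perm V},
  [/\ involutive s, forall x, F (s x) = F x, forall x, s x != x -> far x (s x)
    & #|[set x | s x == x]| <= #|F @: V| * B].
Proof.
pose P (s : {perm V}) :=
  [forall x, [&& s (s x) == x, F (s x) == F x & (s x != x) ==> far x (s x)]].
have P1 : P 1%g by apply/forallP => x; rewrite !perm1 !eqxx.
case: (@arg_maxnP _ _ P (fun s => #|[set x | s x != x]|) P1) => s /forallP Ps smax.
have sK : involutive s by move=> x; case/and3P: (Ps x) => /eqP.
have Fs x : F (s x) = F x by case/and3P: (Ps x) => _ /eqP.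
have fars x : s x != x -> far x (s x) by case/and3P: (Ps x) => _ _ /implyP.
exists s; split=> //.
have near x y : s x = x -> s y = y -> F x = F y -> ~~ far x y.
  move=> sx sy Fxy; apply/negP => fxy.
  have xy : x != y by apply: contraTneq fxy => ->; rewrite farxx.
  pose s' : {perm V} := (s * tperm x y)%g.
  have s'x : s' x = y by rewrite permM sx tpermL.
  have s'y : s' y = x by rewrite permM sy tpermR.
  have s'E z : z != x -> z != y -> s' z = s z.
    move=> zx zy; rewrite permM tpermD // eq_sym; [rewrite -sx|rewrite -sy];
      by rewrite (inj_eq perm_inj).
  have : P s'.
    apply/forallP => z; have [->|zx] := eqVneq z x.
      by rewrite s'x s'y eqxx Fxy eqxx fxy implybT.
    have [->|zy] := eqVneq z y; first by rewrite s'y s'x eqxx Fxy eqxx farC fxy implybT.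
    rewrite (s'E z) // Fs eqxx.
    rewrite s'E ?sK ?eqxx ?(fun e => introT implyP (fars z)) //.
      exact/implyP/fars.
    - by apply: contraNneq zx => e; rewrite -(sK z) e sx.
    - by apply: contraNneq zy => e; rewrite -(sK z) e sy.
  move/smax; apply/negP; rewrite -ltnNge; apply: proper_card; apply/properP; split.
    apply/fintype.subsetP => z; rewrite !inE.
    case: (eqVneq z x) => [->|zx]; first by rewrite sx eqxx.
    by case: (eqVneq z y) => [->|zy]; [rewrite sy eqxx | rewrite s'E].
  by exists x; rewrite !inE ?sx ?eqxx // s'x eq_sym.
rewrite -sum1_card (partition_big F (mem (F @: V))) /=; last by move=> x _; apply: imset_f.
rewrite -sum_nat_const; apply: leq_sum => a _.
have [x /andP[sx /eqP Fx]|none] := pickP (fun x => (s x == x) && (F x == a)); last first.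
  by rewrite big_pred0 // => x; rewrite inE none.
rewrite sum1_card; apply: leq_trans (nearB x); apply: subset_leq_card.
apply/fintype.subsetP => y; rewrite unfold_in inE => /andP[/eqP sy /eqP Fy].
by rewrite inE; apply: near; rewrite ?(eqP sx) ?Fx ?Fy.
Qed.
End Matching.

(** * Alternating colour steps and jumps *)
Section Jumps.
Local Open Scope nat_scope.
Variables (V C : finType) (p : C -> {perm V}) (g M : nat) (s : {perm V}).
Hypotheses (pK : forall c, involutive (p c)) (gg : girth_gt p g).
Let N := (M.*2).+1.
Hypothesis (Mg : 3 * N <= g).
Hypothesis (sK : involutive s).

Definition pos (cs : seq C) (x : V) : V := foldl (fun y c => s (p c y)) (s x) cs.

Definition jump (x : V) : nat := tdist p N x (s x).

(* The jump out of the [j]-th stop and the jump into it have the same length, because [s] is an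
   involution; hence the sum may run over the positions reached after the jumps. *)
Definition travel (cs : seq C) (x : V) : nat :=
  \sum_(j < (size cs).+1) jump (pos (take j cs) x).

(** Only the jumps are credited, and only up to [M]: that much distance is all the demand needs. *)
Definition straight (cs : seq C) : pred V :=
  fun x => minn M (travel cs x) <= tdist p N x (pos cs x).

Lemma pos_rcons cs c x : pos (rcons cs c) x = s (p c (pos cs x)).
Proof. by rewrite /pos -cats1 foldl_cat. Qed.

Lemma pos_inj cs : injective (pos cs).
Proof.
elim/last_ind: cs => [|cs c IH] x y; first exact: perm_inj.
by rewrite !pos_rcons => /perm_inj/perm_inj/IH.
Qed.

Lemma jump_s x : jump (s x) = jump x.
Proof. by rewrite /jump sK tdist_sym. Qed.

Lemma travel_rcons cs c x :
  travel (rcons cs c) x = travel cs x + jump (p c (pos cs x)).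
Proof.
rewrite /travel size_rcons big_ord_recr /= -[(size cs).+1](size_rcons cs c) take_size.
rewrite pos_rcons jump_s; congr (_ + _); apply: eq_bigr => j _.
by case: j => j /= jlt; rewrite -cats1 takel_cat // -ltnS -(size_rcons cs c).
Qed.

Hypothesis jump_lt : forall x, jump x < M.

Lemma straight_nil x : straight [::] x.
Proof.
rewrite /straight /travel big_ord1 /pos /= /jump sK (tdist_sym pK).
exact: geq_minr.
Qed.

(* While the walk stays within distance [2M] of [x], both the colour step and the jump increase
   the distance; once it is further away, a jump shorter than [M] cannot bring it back within
   [M]. *)
Lemma straight_rcons cs c x : straight cs x ->
  p c (pos cs x) != pos cs x -> ~~ toward p N x (pos cs x) c ->
  ~~ toward p N (s (p c (pos cs x))) (p c (pos cs x)) c ->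
  straight (rcons cs c) x.
Proof.
rewrite /straight travel_rcons pos_rcons; set u := pos cs x; set v := p c u.
move=> st vu away1 away2; have jv := jump_lt v.
have tri := tdist_triangle pK N x (s v) v.
have NM : N = M.*2.+1 by [].
have pv : p c v = u by rewrite /v pK.
rewrite [tdist p N (s v) v]tdist_sym // -/(jump v) in tri.
have [ltN|geN] := ltnP (tdist p N x u) N; last first.
  have := tdist_triangle pK N x v u; have := tdist_step pK N v c.
  rewrite pv => h1 h2; rewrite -/N in geN; lia.
have up := tdist_away pK gg Mg ltN vu away1; rewrite -/v in up.
have [ltN'|geN'] := ltnP (tdist p N x v) N; last by lia.
have tw : toward p N x v c by rewrite /toward pv up.
have ltj : tdist p N v (s v) < N by rewrite -/(jump v); lia.
have := tdist_jump pK gg Mg tw ltj away2; rewrite -/(jump v) up; lia.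
Qed.

(** Double counting: by [toward_inj] each [x] is counted for at most one colour. *)
Lemma sum_toward (f h : V -> V) (P : pred C) :
  \sum_(c | P c) #|[set x | toward p N (f x) (h x) c]| <= #|V|.
Proof.
rewrite -sum1_card.
under eq_bigr do rewrite -sum1_card big_mkcond /=.
rewrite exchange_big leq_sum // => x _ /=.
under eq_bigr do rewrite inE.
have [c tc|none] := pickP (toward p N (f x) (h x)); last first.
  by rewrite big1 // => c _; rewrite none.
rewrite (@leq_trans (\sum_c if toward p N (f x) (h x) c then 1 else 0)) //.
  by rewrite [in X in _ <= X](bigID P) /= leq_addr.
rewrite (bigD1 c) //= tc big1 // => c' ne.
by case: ifP => // tc'; rewrite (toward_inj pK gg Mg tc' tc) eqxx in ne.
Qed.

(* Averaging: for given [x] and [u] at most one colour leads from [u] towards [x]. *)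
Lemma exists_next_color k (cs : seq C) : uniq cs -> size cs <= k -> k < #|C| ->
  exists2 c, c \notin cs & (#|C| - k) *
    (#|[set x | toward p N x (pos cs x) c]| +
     #|[set v | toward p N (s v) v c]|) <= 2 * #|V|.
Proof.
move=> ucs szk kC.
pose b c := #|[set x | toward p N x (pos cs x) c]| + #|[set v | toward p N (s v) v c]|.
have [c /andP[cN lec]|none] :=
  pickP (fun c => (c \notin cs) && ((#|C| - k) * b c <= 2 * #|V|)); first by exists c.
have bigE c : c \notin cs -> (2 * #|V|).+1 <= (#|C| - k) * b c.
  by move=> cN; rewrite ltnNge; move: (none c); rewrite cN /= => ->.
have total : \sum_(c | c \notin cs) b c <= 2 * #|V|.
  by rewrite /b big_split /= mul2n -addnn leq_add // sum_toward.
have : \sum_(c | c \notin cs) (2 * #|V|).+1 <= \sum_(c | c \notin cs) (#|C| - k) * b c.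
  exact: leq_sum.
rewrite sum_nat_const -big_distrr /=.
have -> : #|[pred c | c \notin cs]| = #|C| - size cs.
  by rewrite -(card_uniqP ucs) -(cardC (mem cs)) addKn; apply: eq_card.
rewrite leqNgt => /negP[].
apply: (@leq_ltn_trans ((#|C| - k) * (2 * #|V|))); first by rewrite leq_mul2l total orbT.
apply: (@leq_ltn_trans ((#|C| - size cs) * (2 * #|V|))).
  by rewrite leq_mul2r leq_sub2l ?orbT.
by rewrite ltn_pmul2l // subn_gt0 (leq_ltn_trans szk).
Qed.

(** Colours are chosen one at a time. A new colour spoils the walks that meet a missing edge or
    backtrack before or after the jump; positions are injective in [x], so these sets of starting
    points are no larger than the sets of bad positions. Distinct colours later let each colour
    class serve a route only once. *)
Lemma exists_colors k fx : k < #|C| -> (forall c, #|[set x | p c x == x]| <= fx) ->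
  exists cs : seq C, [/\ uniq cs, size cs = k &
    (#|C| - k) * #|[set x | ~~ straight cs x]| <= k * ((#|C| - k) * fx + 2 * #|V|)].
Proof.
move=> kC fixed.
suff: forall j, j <= k -> exists cs : seq C, [/\ uniq cs, size cs = j &
    (#|C| - k) * #|[set x | ~~ straight cs x]| <= j * ((#|C| - k) * fx + 2 * #|V|)].
  by apply.
elim=> [_|j IH jk].
  exists [::]; split=> //; rewrite (_ : [set x | _] = finset.set0) ?cards0 ?muln0 //.
  by apply/setP => x; rewrite !inE straight_nil.
have [cs [ucs szcs le]] := IH (ltnW jk).
have [c cN lec] := exists_next_color ucs (eq_leq szcs : _ <= j) (leq_ltn_trans (ltnW jk) kC).
have {}lec : (#|C| - k) * (#|[set x | toward p N x (pos cs x) c]| +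
     #|[set v | toward p N (s v) v c]|) <= 2 * #|V|.
  by apply: leq_trans lec; rewrite leq_mul2r leq_sub2l ?orbT // ltnW.
exists (rcons cs c); split; first by rewrite rcons_uniq cN.
  by rewrite size_rcons szcs.
pose U := [set x | p c x == x]; pose W := [set v | toward p N (s v) v c].
have sub : [set x | ~~ straight (rcons cs c) x] \subset
    [set x | ~~ straight cs x] :|: (pos cs @^-1: U :|:
      ([set x | toward p N x (pos cs x) c] :|: (fun x => p c (pos cs x)) @^-1: W)).
  apply/fintype.subsetP => x; rewrite !inE.
  apply: contraR; rewrite !negb_or !negbK => /and4P[st mv a1 a2].
  exact: straight_rcons.
have pre (f : V -> V) (A : {set V}) : injective f -> #|f @^-1: A| <= #|A|.
  move=> f_inj; rewrite -(card_imset _ f_inj); apply: subset_leq_card.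
  by apply/fintype.subsetP => _ /imsetP[x xA ->]; rewrite inE in xA.
have cU := leq_trans (pre _ U (@pos_inj cs)) (fixed c).
have cW : #|(fun x => p c (pos cs x)) @^-1: W| <= #|W|.
  by apply: pre => x y /perm_inj/pos_inj.
have := subset_leq_card sub.
have c1 := leq_card_setU [set x | ~~ straight cs x] (pos cs @^-1: U :|:
      ([set x | toward p N x (pos cs x) c] :|: (fun x => p c (pos cs x)) @^-1: W)).
have c2 := leq_card_setU (pos cs @^-1: U)
      ([set x | toward p N x (pos cs x) c] :|: (fun x => p c (pos cs x)) @^-1: W).
have c3 := leq_card_setU [set x | toward p N x (pos cs x) c]
   ((fun x => p c (pos cs x)) @^-1: W).
have {}c1 := leq_of_leqif c1; have {}c2 := leq_of_leqif c2; have {}c3 := leq_of_leqif c3.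
move=> c0; rewrite mulSn addnC.
apply: (@leq_trans ((#|C| - k) * (#|[set x | ~~ straight cs x]| + (fx +
  (#|[set x | toward p N x (pos cs x) c]| + #|W|))))).
  by rewrite leq_mul2l; apply/orP; right; lia.
by rewrite mulnDr leq_add // mulnDr leq_add2l.
Qed.

(** At most [1/25] of the walks are not straight. By averaging, at most [2 * ng], that is [13/25],
    have short jumps at more than half of their [k.+1] stops. The rest travel at least
    [k.+1 * b / 2 >= M], and [1 - 14/25] exceeds [1/4]. *)
Lemma many_far k b ng fx : k < #|C| -> (forall c, #|[set x | p c x == x]| <= fx) ->
  100 * (k * fx) <= #|V| -> 200 * k <= 3 * (#|C| - k) -> M.*2 <= k.+1 * b ->
  #|[set x | jump x < b]| <= ng -> 50 * ng <= 13 * #|V| ->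
  exists cs : seq C, uniq cs /\ #|V| <= 4 * #|[set x | M <= tdist p N x (pos cs x)]|.
Proof.
move=> kC fixed kfx Ck Mk few ngV.
have [cs [ucs szcs X_le]] := exists_colors kC fixed.
exists cs; split=> //; set X := #|_| in X_le.
have {}X_le : 25 * X <= #|V|.
  have dk : 0 < #|C| - k by rewrite subn_gt0.
  have : 100 * ((#|C| - k) * X) <= (#|C| - k) * (4 * #|V|) by nia.
  by rewrite mulnCA leq_pmul2l //; lia.
pose cnt x := \sum_(j < k.+1) (jump (pos (take j cs) x) < b).
(* Markov's inequality for [cnt] will bound [E]; each stop contributes at most [ng], since the
   position there is injective in [x]. *)
pose E := [set x | k.+1 < 2 * cnt x].
have cnt_le : \sum_x cnt x <= k.+1 * ng.
  rewrite exchange_big /=; apply: (@leq_trans (\sum_(j < k.+1) ng)); last first.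
    by rewrite sum_nat_const card_ord.
  apply: leq_sum => j _; apply: leq_trans few.
  have -> : \sum_x (jump (pos (take j cs) x) < b : nat) =
      #|[set x | jump (pos (take j cs) x) < b]|.
    by rewrite -sum1_card [RHS]big_mkcond; apply: eq_bigr => x _; rewrite inE; case: ltnP.
  rewrite -(card_imset _ (@pos_inj (take j cs))); apply: subset_leq_card.
  by apply/fintype.subsetP => _ /imsetP[x xj ->]; move: xj; rewrite !inE.
have E_le : #|E| <= 2 * ng.
  rewrite -(@leq_pmul2l k.+1) // mulnCA.
  apply: (@leq_trans (2 * \sum_x cnt x)); last by rewrite leq_mul2l cnt_le.
  rewrite big_distrr /= mulnC -sum_nat_const.
  rewrite [X in _ <= X](bigID (mem E)) /=; apply: leq_trans (leq_addr _ _).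
  by apply: leq_sum => x; rewrite inE => /ltnW.
have sub : ~: [set x | M <= tdist p N x (pos cs x)] \subset [set x | ~~ straight cs x] :|: E.
  apply/fintype.subsetP => x; rewrite !inE -ltnNge => lt.
  apply: contraLR lt; rewrite negb_or negbK -!leqNgt => /andP[st le].
  apply: leq_trans st; rewrite leq_min leqnn /=.
  have : \sum_(j < k.+1) b <= travel cs x + b * cnt x.
    rewrite /travel szcs /cnt big_distrr -big_split /=; apply: leq_sum => j _.
    by case: (ltnP (jump _) b) => [_|le']; rewrite ?muln1 ?muln0 ?addn0 ?leq_addl.
  rewrite sum_nat_const card_ord => h.
  have h2 : 2 * (b * cnt x) <= b * k.+1 by rewrite mulnCA leq_mul2l le orbT.
  rewrite mulnC in Mk; lia.
have := subset_leq_card sub; have := leq_of_leqif (leq_card_setU [set x | ~~ straight cs x] E).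
rewrite -/X -(cardsC [set x | M <= tdist p N x (pos cs x)]) in X_le ngV *.
lia.
Qed.
End Jumps.

(** * Bijective walks that end far away *)

Section Route.
Local Open Scope nat_scope.

Lemma exists_route (V C Q : finType) (F : V -> Q) (p : C -> {perm V}) (g M b k fx : nat) :
  (forall c, involutive (p c)) -> girth_gt p g -> (3 * M.*2.+1 <= g) ->
  (0 < b <= M) -> (k < #|C|) -> (forall c, #|[set x | p c x == x]| <= fx) ->
  (100 * (k * fx) <= #|V|) -> (200 * k <= 3 * (#|C| - k)) -> (M.*2 <= k.+1 * b) ->
  (100 * (#|F @: V| * #|C|.+1 ^ b) <= #|V|) ->
  exists (s : {perm V}) (cs : seq C), [/\ forall x, F (s x) = F x, uniq cs
    & (#|V| <= 4 * #|[set x | M <= tdist p M.*2.+1 x (pos p s cs x)]|)].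
Proof.
move=> pK gg Mg /andP[b0 bM] kC fixed kfx Ck Mk parts.
set N := M.*2.+1 in Mg *.
pose far x y := (b <= tdist p N x y).
have [||x|s [sK Fs fars s_fix]] := @exists_far_matching V Q F far (#|C|.+1 ^ b).
- by move=> x y; rewrite /far (tdist_sym pK).
- by move=> x; rewrite /far tdistxx // leqNgt b0.
- apply: leq_trans (card_cball p b x); apply: subset_leq_card.
  apply/fintype.subsetP => y; rewrite inE /far -ltnNge => /ltnW.
  rewrite (tdist_le pK) leqNgt (_ : b < N) //=.
  by rewrite /N ltnS (leq_trans bM) // -addnn leq_addr.
have [large|small] := leqP #|V| (4 * #|[set x | M <= jump p M s x]|).
  by exists s, [::].
(* Jumps of length [M] or more are suppressed, as [many_far] needs all jumps shorter than [M]. The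
   result is still an involution because [jump] agrees at [x] and [s x]. *)
pose f x := if (jump p M s x < M) then s x else x.
have jump_sx x : jump p M s (s x) = jump p M s x by apply: jump_s.
have fK : involutive f.
  move=> x; rewrite /f; have [lt|/leq_gtF ge] := ltnP (jump p M s x) M.
    by rewrite jump_sx lt sK.
  by rewrite ge.
pose s' := perm (inv_inj fK).
have s'E x : s' x = f x by rewrite permE.
have jumpE x : jump p M s' x = if (jump p M s x < M) then jump p M s x else 0.
  by rewrite {1}/jump s'E /f; case: ltnP => // _; rewrite tdistxx.
(* Short jumps now occur only at unmatched vertices, at most [1/100] of all, and at suppressed ones,
   fewer than [1/4]; together at most [13/50]. *)
have [||||cs [ucs le]] := @many_far V C p g M s' pK gg Mg _ _ k b
  (#|[set x | s x == x]| + #|[set x | M <= jump p M s x]|) fx kC fixed kfx Ck Mk.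
- by move=> x; rewrite !s'E fK.
- by move=> x; rewrite jumpE; case: ifP => // _; rewrite (leq_trans b0).
- apply: leq_trans (leq_of_leqif (leq_card_setU _ _)); apply: subset_leq_card.
  apply/fintype.subsetP => x; rewrite !inE jumpE.
  case: (ltnP (jump p M s x) M) => [_|]; last by rewrite orbT.
  rewrite orbF; apply: contraLR => /fars; rewrite /far -leqNgt; exact.
- by rewrite mulnDr; lia.
exists s', cs; split=> // x.
by rewrite s'E /f; case: ifP.
Qed.
End Route.

(** * Weak duality for congestion, and flows in contracted graphs *)
Section FlowLemmas.
Variable R : realType.

Lemma netflowE (W E : finType) (ends : E -> W * W) (f : E -> R) v :
  netflow ends f v = \sum_e f e * (((ends e).1 == v)%:R - ((ends e).2 == v)%:R).
Proof.
rewrite /netflow big_mkcond [X in _ - X]big_mkcond -sumrB; apply: eq_bigr => e _.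
by rewrite mulrBr !mulr_natr !mulrb.
Qed.

Lemma sum_netflow (W E : finType) (ends : E -> W * W) (f : E -> R) (h : W -> R) :
  \sum_v h v * netflow ends f v = \sum_e f e * (h (ends e).1 - h (ends e).2).
Proof.
under eq_bigr do rewrite netflowE big_distrr /=.
rewrite exchange_big; apply: eq_bigr => e _ /=.
have pick w : \sum_v h v * (w == v)%:R = h w.
  rewrite (bigD1 w) //= eqxx mulr1 big1 ?addr0 // => v vw.
  by rewrite eq_sym (negbTE vw) mulr0.
rewrite -[in RHS](pick (ends e).1) -[in RHS](pick (ends e).2) -sumrB mulr_sumr.
by apply: eq_bigr => v _; ring.
Qed.

(** Here [len] is a length on edges and [h k] a potential that is Lipschitz for it. Summation by
    parts bounds the weighted demand by the total of load times length, hence by the congestion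
    times the volume. *)
Lemma cong_ge (W E K : finType) (ends : E -> W * W) (cap : E -> R) (src snk : K -> W)
    (d : K -> R) (len : E -> R) (h : K -> W -> R) (A vol : R) :
  (forall e, 0 < cap e) -> (forall e, 0 <= len e) ->
  (forall k e, `|h k (ends e).1 - h k (ends e).2| <= len e) ->
  0 < vol -> \sum_e cap e * len e <= vol ->
  A <= \sum_k d k * (h k (src k) - h k (snk k)) ->
  ((A / vol)%:E <= cong ends cap src snk d)%E.
Proof.
move=> cap0 len0 lip vol0 le_vol leA; apply: le_ereal_inf_tmp => _ [f rf <-].
rewrite lee_fin ler_pdivrMr //; apply: (le_trans leA).
have load e : \sum_k `|f k e| <= congestion cap f * cap e.
  rewrite -ler_pdivrMr //; exact: (le_bigmax _ (fun e => (\sum_k `|f k e|) / cap e)).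
have c0 : 0 <= congestion cap f.
  by rewrite /congestion; elim/big_rec: _ => // e x _; rewrite le_max => ->; rewrite orbT.
apply: (@le_trans _ _ (\sum_e len e * \sum_k `|f k e|)); last first.
  apply: (@le_trans _ _ (\sum_e congestion cap f * (cap e * len e))).
    by apply: ler_sum => e _; rewrite mulrA [leLHS]mulrC ler_wpM2r.
  by rewrite -mulr_sumr ler_wpM2l.
under [leRHS]eq_bigr do rewrite mulr_sumr.
rewrite exchange_big; apply: ler_sum => k _ /=.
have -> : d k * (h k (src k) - h k (snk k)) = \sum_v h k v * netflow ends (f k) v.
  under eq_bigr do rewrite rf mulrCA mulrBr.
  rewrite -mulr_sumr sumrB; congr (_ * (_ - _)).
    rewrite (bigD1 (src k)) //= eqxx mulr1 big1 ?addr0 // => v vw.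
    by rewrite (negbTE vw) mulr0.
  rewrite (bigD1 (snk k)) //= eqxx mulr1 big1 ?addr0 // => v vw.
  by rewrite (negbTE vw) mulr0.
rewrite sum_netflow; apply: ler_sum => e _.
apply: (le_trans (ler_norm _)); rewrite normrM mulrC ler_wpM2r //.
Qed.

Section Contraction.
Variables (n m : nat) (ends : 'I_m -> 'I_n * 'I_n) (cap : 'I_m -> R).
Variables (P : {set {set 'I_n}}) (T : {set 'I_n}) (I : finType) (a b : I -> 'I_n).

(** One unit for each [i], entered in both orders because [dem] reads only increasing pairs; an
    index with [a i = b i] falls on the diagonal, which [dem] discards. *)
Definition unit_demand (t t' : 'I_n) : R :=
  \sum_i (((a i, b i) == (t, t'))%:R + ((a i, b i) == (t', t))%:R).

Hypothesis partP : finset.partition P [set: 'I_n].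

Lemma eq_pblock_in (X : {set 'I_n}) v : X \in P -> (finset.pblock P v == X) = (v \in X).
Proof.
case/and3P: partP => /eqP cov triv _ XP; apply/eqP/idP => [<-|vX].
  by rewrite mem_pblock cov inE.
exact: def_pblock triv XP vX.
Qed.

Lemma pblock_in v : finset.pblock P v \in P.
Proof. by case/and3P: partP => /eqP cov _ _; apply: pblock_mem; rewrite cov inE. Qed.

(* [f] need not be conserved inside a part: it may enter a part at one vertex and leave it
   at another. *)
Lemma netflow_contract (f : 'I_m -> R) (X : {set 'I_n}) : X \in P ->
  netflow (E := {e : 'I_m | crossing ends P e})
    (fun e => (finset.pblock P (ends (val e)).1, finset.pblock P (ends (val e)).2))
    (fun e => f (val e)) X = \sum_(v in X) netflow ends f v.
Proof.
move=> XP; rewrite netflowE /=.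
pose G e := f e * (((ends e).1 \in X)%:R - ((ends e).2 \in X)%:R) : R.
transitivity (\sum_(e : {e : 'I_m | crossing ends P e}) G (val e)).
  by apply: eq_bigr => e _; rewrite !eq_pblock_in.
rewrite -(big_sub (crossing ends P) G).
rewrite [RHS](_ : _ = \sum_v (v \in X)%:R * netflow ends f v); last first.
  by rewrite big_mkcond; apply: eq_bigr => v _; rewrite mulr_natl mulrb.
rewrite (sum_netflow ends f (fun v => (v \in X)%:R)) big_mkcond.
apply: eq_bigr => e _; case: ifP => //; rewrite unfold_in /crossing => /negbFE/eqP ee.
by rewrite -!eq_pblock_in // ee subrr mulr0.
Qed.

Hypotheses (aT : forall i, a i \in T) (bT : forall i, b i \in T).

Lemma congH_le (phi : I -> 'I_m -> R) (kappa : R) : 0 <= kappa ->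
  (forall e, 0 < cap e) ->
  (forall i X, X \in P -> \sum_(v in X) netflow ends (phi i) v = (a i \in X)%:R - (b i \in X)%:R) ->
  (forall e, \sum_i `|phi i e| <= kappa * cap e) ->
  (congH ends cap P T unit_demand <= kappa%:E)%E.
Proof.
move=> kappa0 cap0 phiP load.
pose ok (k : 'I_n * 'I_n) := [&& k.1 \in T, k.2 \in T & (k.1 < k.2)%N].
(* All [phi i] between the same two terminals are merged into one commodity, reversed when [a i] and
   [b i] come in the opposite order. *)
pose f (k : 'I_n * 'I_n) (e : 'I_m) : R := if ok k then
  \sum_i (((a i, b i) == k)%:R - ((a i, b i) == (k.2, k.1))%:R) * phi i e else 0.
apply: (@le_trans _ _ (congestion (fun e : {e | crossing ends P e} => cap (val e))
    (fun k e => f k (val e)))%:E).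
  apply: ereal_inf_lbound; exists (fun k e => f k (val e)) => //= k X.
  have [XP|XP] := boolP (X \in P); last first.
    have nX v : (finset.pblock P v == X) = false.
      by apply: contraNF XP => /eqP <-; apply: pblock_in.
    rewrite ![X == _]eq_sym !nX subrr mulr0 netflowE big1 // => e _.
    by rewrite /= !nX subrr mulr0.
  rewrite netflow_contract // ![X == _]eq_sym !eq_pblock_in // /dem -/(ok k).
  case: ifP => okk; last first.
    rewrite mul0r big1 // => v _; rewrite netflowE big1 // => e _.
    by rewrite /f okk mul0r.
  transitivity (\sum_i (((a i, b i) == k)%:R - ((a i, b i) == (k.2, k.1))%:R) *
      \sum_(v in X) netflow ends (phi i) v).
    under [RHS]eq_bigr do rewrite mulr_sumr.
    rewrite exchange_big; apply: eq_bigr => v _ /=.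
    under [RHS]eq_bigr do rewrite netflowE mulr_sumr.
    rewrite netflowE exchange_big; apply: eq_bigr => e _ /=.
    by rewrite /f okk mulr_suml; apply: eq_bigr => i _; rewrite mulrA.
  rewrite /unit_demand mulr_suml; apply: eq_bigr => i _.
  rewrite phiP // -surjective_pairing.
  case: k {okk} => k1 k2 /=.
  have [[ea eb]|_] := eqVneq (a i, b i) (k1, k2);
    have [[ea' eb']|_] := eqVneq (a i, b i) (k2, k1); rewrite /= ?add0r ?mul0r ?addr0 //.
  - by rewrite -ea' -eb' (_ : a i = b i) ?subrr ?mulr0 // ea' eb.
  - by rewrite ea eb subr0.
  - by rewrite ea' eb'; ring.
  by ring.
rewrite lee_fin; apply: bigmax_le => // e _.
rewrite ler_pdivrMr //; apply: le_trans (load (val e)).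
apply: (@le_trans _ _ (\sum_k \sum_i
    (ok k)%:R * (((a i, b i) == k)%:R + ((a i, b i) == (k.2, k.1))%:R) * `|phi i (val e)|)).
  apply: ler_sum => k _; rewrite /f; case: (ok k); last first.
    by rewrite normr0 sumr_ge0 // => i _; rewrite !mul0r.
  apply: (le_trans (ler_norm_sum _ _ _)); apply: ler_sum => i _.
  rewrite normrM mul1r ler_wpM2r //.
  by apply: (le_trans (ler_normB _ _)); rewrite !ger0_norm.
rewrite exchange_big; apply: ler_sum => i _ /=.
rewrite -mulr_suml ler_piMl //.
(* At most one order of the two terminals of [i] is increasing, so [phi i] is counted at most
   once. *)
under eq_bigr do rewrite mulrDr.
rewrite big_split /=.
rewrite (bigD1 (a i, b i)) //= big1 ?addr0 => [|k ne]; last first.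
  by rewrite eq_sym (negbTE ne) mulr0.
rewrite (bigD1 (b i, a i)) //= big1 ?addr0 => [|[k1 k2] ne]; last first.
  by rewrite xpair_eqE [a i == _]eq_sym [b i == _]eq_sym andbC -xpair_eqE (negbTE ne) mulr0.
rewrite !eqxx !mulr1 /ok /= !aT !bT /=.
by case: ltngtP => _; rewrite ?addr0 ?add0r.
Qed.
End Contraction.
End FlowLemmas.

(** * The graph *)
Section Construction.
Variables (R : realType) (s t : nat) (C : finType) (p : C -> {perm 'I_s}).
Variables (tau : 'I_s -> 'I_t) (cent : 'I_t -> 'I_s).

(** A coloured edge appears twice, once from each end, as parallel edges; the [inr] edges join base
    vertices to their terminals. *)
Definition edge : finType := ((C * 'I_s) + 'I_s)%type.

(* A colour missing at [x] is represented by an extra copy of the edge from [x] to its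
   terminal, so that no edge is a loop. *)
Definition edge_ends (e : edge) : 'I_(s + t) * 'I_(s + t) :=
  match e with
  | inl (c, x) => (lshift t x, if p c x == x then rshift s (tau x) else lshift t (p c x))
  | inr x => (lshift t x, rshift s (tau x))
  end.

Definition gends (e : 'I_#|edge|) := edge_ends (enum_val e).

Definition terminals : {set 'I_(s + t)} := [set rshift s j | j in 'I_t].

(** Projecting terminals to their centres extends base distances to all vertices of the graph. *)
Definition center (v : 'I_(s + t)) : 'I_s :=
  match fintype.split v with inl x => x | inr j => cent j end.

Lemma center_l x : center (lshift t x) = x.
Proof. by rewrite /center (unsplitK (inl x)). Qed.

Lemma center_r j : center (rshift s j) = cent j.
Proof. by rewrite /center (unsplitK (inr j)). Qed.

Lemma card_terminals : #|terminals| = t.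
Proof. by rewrite card_imset ?card_ord //; apply: rshift_inj. Qed.

Lemma gends_neq e : (gends e).1 != (gends e).2.
Proof.
rewrite /gends; case: (enum_val e) => [[c x]|x] /=; last by rewrite eq_lrshift.
case: ifP => [_|]; first by rewrite eq_lrshift.
by rewrite eq_lshift eq_sym => ->.
Qed.

Lemma sum_edges (F : edge -> R) : \sum_(e < #|edge|) F (enum_val e) =
  \sum_c \sum_x F (inl (c, x)) + \sum_x F (inr x).
Proof.
rewrite -(big_enum_val (A := edge) F) /=.
rewrite (eq_bigl xpredT) // big_sumType /=; congr (_ + _).
by rewrite pair_big; apply: eq_bigr => -[].
Qed.

Hypothesis pK : forall c, involutive (p c).

(** * Lower bound for the congestion in [G] *)

Section Lower.
Variables (rho fx N : nat).
Hypothesis tau_near : forall x, cent (tau x) \in cball p (2 * rho) x.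
Hypothesis few_stuck : forall c, (#|[set x | p c x == x]| <= fx)%N.

(** An edge to a terminal gets [2 * rho], which bounds the distance from its base end to the centre;
    this makes [potential] Lipschitz. *)
Definition edge_len (e : edge) : R :=
  match e with
  | inl (c, x) => if p c x == x then (2 * rho)%:R else 1
  | inr x => (2 * rho)%:R
  end.

Definition potential (k : 'I_(s + t) * 'I_(s + t)) (v : 'I_(s + t)) : R :=
  (tdist p N (center k.2) (center v))%:R.

Lemma tdist_lip z x y m : (tdist p N x y <= m)%N ->
  `|(tdist p N z x)%:R - (tdist p N z y)%:R| <= m%:R :> R.
Proof.
move=> le; have h1 := tdist_triangle pK N z x y; have h2 := tdist_triangle pK N z y x.
rewrite (tdist_sym pK N y x) in h2.
rewrite ler_norml; apply/andP; split.
  by rewrite lerBrDr addrC lerBlDr -natrD ler_nat (leq_trans h1) // leq_add2l.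
by rewrite lerBlDr -natrD ler_nat (leq_trans h2) // addnC leq_add2r.
Qed.

Lemma potential_lip k e :
  `|potential k (gends e).1 - potential k (gends e).2| <= edge_len (enum_val e).
Proof.
have port x : (tdist p N x (cent (tau x)) <= 2 * rho)%N by rewrite tdist_le // tau_near orbT.
rewrite /potential /gends; case: (enum_val e) => [[c x]|x] /=; last first.
  by rewrite center_l center_r tdist_lip.
case: ifP => _; first by rewrite center_l center_r tdist_lip.
by rewrite !center_l -(mulr1n 1) tdist_lip // tdist_step.
Qed.

Lemma sum_edge_len : \sum_(e < #|edge|) edge_len (enum_val e) <=
  (#|C| * s + #|C| * fx * (2 * rho) + s * (2 * rho))%:R.
Proof.
rewrite sum_edges !natrD lerD //=; last first.
  by rewrite sumr_const card_ord -[_ *+ s]mulr_natl -natrM.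
rewrite -natrD -mulnA -mulnDr.
apply: (@le_trans _ _ (\sum_(c : C) (s + fx * (2 * rho))%:R)); last first.
  by rewrite sumr_const -[_ *+ _]mulr_natl -natrM.
apply: ler_sum => c _; rewrite natrD (natrM _ fx).
apply: (@le_trans _ _ (\sum_x (1 + (p c x == x)%:R * (2 * rho)%:R))).
  apply: ler_sum => x _ /=; case: eqP => _; first by rewrite mul1r lerDr.
  by rewrite mul0r addr0.
rewrite big_split /= sumr_const card_ord lerD2l -mulr_suml ler_wpM2r //.
rewrite -natr_sum ler_nat; apply: leq_trans (few_stuck c).
by rewrite -sum1_card [leqRHS]big_mkcond; apply: leq_sum => x _; rewrite inE; case: eqP.
Qed.

(** [dem] keeps one order of each pair, which symmetry of [w] compensates, and drops the diagonal,
    where [w] vanishes. *)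
Lemma sum_dem (I : finType) (a b : I -> 'I_(s + t)) (w : 'I_(s + t) -> 'I_(s + t) -> R) :
  (forall i, a i \in terminals) -> (forall i, b i \in terminals) ->
  (forall u v, w u v = w v u) -> (forall v, w v v = 0) ->
  \sum_k dem terminals (unit_demand R a b) k * w k.1 k.2 = \sum_i w (a i) (b i).
Proof.
move=> aT bT wC wvv.
pose ok (k : 'I_(s + t) * 'I_(s + t)) := [&& k.1 \in terminals, k.2 \in terminals & (k.1 < k.2)%N].
transitivity (\sum_k \sum_i (ok k)%:R *
    (((a i, b i) == k)%:R + ((a i, b i) == (k.2, k.1))%:R) * w k.1 k.2).
  apply: eq_bigr => k _; rewrite /dem -/(ok k) /unit_demand -surjective_pairing.
  case: (ok k); last by rewrite mul0r big1 // => i _; rewrite !mul0r.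
  by rewrite mulr_suml; apply: eq_bigr => i _; rewrite mul1r.
rewrite exchange_big; apply: eq_bigr => i _ /=.
under eq_bigr do rewrite mulrDr mulrDl.
rewrite big_split /=.
rewrite (bigD1 (a i, b i)) //= big1 ?addr0 => [|k ne]; last first.
  by rewrite eq_sym (negbTE ne) mulr0 mul0r.
rewrite (bigD1 (b i, a i)) //= big1 ?addr0 => [|[k1 k2] ne]; last first.
  by rewrite xpair_eqE [a i == _]eq_sym [b i == _]eq_sym andbC -xpair_eqE (negbTE ne) mulr0 mul0r.
rewrite !eqxx !mulr1 /ok /= !aT !bT /= (wC (b i)).
by case: ltngtP => [_|_|/val_inj ->]; rewrite ?wvv ?mul1r ?mul0r ?addr0 ?add0r.
Qed.

(** For a quarter of the base vertices the two centres are at distance at least [M - 4 * rho]: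
    passing from a vertex to its centre costs at most [2 * rho] at either end. *)
Lemma congG_ge (Phi : 'I_s -> 'I_s) (M : nat) (vol : R) : (0 < s)%N ->
  (4 * rho <= M)%N ->
  (s <= 4 * #|[set x | M <= tdist p N x (Phi x)]%N|)%N ->
  0 < vol -> (#|C| * s + #|C| * fx * (2 * rho) + s * (2 * rho))%:R <= vol ->
  (((s%:R / 4 * (M - 4 * rho)%:R) / vol)%:E <=
   congG gends (fun=> 1%R) terminals
     (unit_demand R (fun x => rshift s (tau x)) (fun x => rshift s (tau (Phi x)))))%E.
Proof.
move=> s0 rM far vol0 volE; apply: (@cong_ge R _ _ _ _ _ _ _ _
  (fun e => edge_len (enum_val e)) potential) => //.
- by move=> e; case: (enum_val e) => [[c x]|x] //=; case: ifP.
- exact: potential_lip.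
- by under eq_bigr do rewrite mul1r; apply: le_trans volE; apply: sum_edge_len.
under eq_bigr do rewrite /potential (tdistxx pK N (center _)) subr0.
rewrite (@sum_dem _ _ _ (fun u v => (tdist p N (center v) (center u))%:R)); last first.
- by move=> v; rewrite tdistxx.
- by move=> u v; rewrite tdist_sym.
- by move=> i; apply: imset_f.
- by move=> i; apply: imset_f.
apply: (@le_trans _ _ (\sum_(x in [set x | M <= tdist p N x (Phi x)]%N) (M - 4 * rho)%:R)).
  rewrite sumr_const -[leRHS]mulr_natl ler_wpM2r // ler_pdivrMr // -natrM ler_nat.
  by rewrite mulnC.
rewrite big_mkcond; apply: ler_sum => x _; rewrite !center_r inE.
case: ifP => // le; rewrite ler_nat leq_subLR.
have port y : (tdist p N y (cent (tau y)) <= 2 * rho)%N by rewrite tdist_le // tau_near orbT.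
have h1 := tdist_triangle pK N x (cent (tau x)) (Phi x).
have h2 := tdist_triangle pK N (cent (tau x)) (cent (tau (Phi x))) (Phi x).
have h3 := port x; have h4 := port (Phi x).
rewrite (tdist_sym pK N (Phi x)) in h4.
rewrite (tdist_sym pK N (cent (tau (Phi x))) (cent (tau x))).
lia.
Qed.
End Lower.

(** * Upper bound for the congestion in [H] *)

Section Upper.
Variables (sigma : {perm 'I_s}) (cs : seq C).
Hypothesis ucs : uniq cs.

(** The place where the walk from [x] takes its step of colour [c]. For [c] outside [cs] it is the
    final position, which [route] ignores. *)
Definition departure (c : C) (x : 'I_s) : 'I_s := pos p sigma (take (index c cs) cs) x.

(** One unit goes from the terminal of [x] down to [x], along the colour steps, and up to the
    terminal of the last position. Jumps carry no flow, being free in [H]. *)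
Definition route (x : 'I_s) (e : edge) : R :=
  match e with
  | inl (c, y) => [&& c \in cs, y == departure c x & p c y != y]%:R
  | inr y => (y == pos p sigma cs x)%:R - (y == x)%:R
  end.

(** The colour steps telescope because [h] does not change across a jump; it will be the indicator
    of a part. A step of a missing colour contributes zero on both sides. *)
Lemma sum_route x (h : 'I_(s + t) -> R) :
  (forall y, h (lshift t (sigma y)) = h (lshift t y)) ->
  \sum_(e < #|edge|) route x (enum_val e) * (h (gends e).1 - h (gends e).2) =
  h (rshift s (tau x)) - h (rshift s (tau (pos p sigma cs x))).
Proof.
move=> hs; rewrite /gends.
rewrite (sum_edges (fun e => route x e * (h (edge_ends e).1 - h (edge_ends e).2))) /=.
pose l y := h (lshift t y).
have -> : \sum_c \sum_y [&& c \in cs, y == departure c x & p c y != y]%:R *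
    (h (lshift t y) - h (if p c y == y then rshift s (tau y) else lshift t (p c y))) =
    \sum_(c <- cs) (l (departure c x) - l (p c (departure c x))).
  rewrite [RHS]big_uniq // [RHS]big_mkcond; apply: eq_bigr => c _.
  rewrite (bigD1 (departure c x)) //= eqxx big1 ?addr0 => [|y /negbTE->]; last first.
    by rewrite andbF mul0r.
  case: (c \in cs); last by rewrite mul0r.
  case: eqP => [fix_u|_] /=; last by rewrite mul1r.
  by rewrite mul0r /l fix_u subrr.
have -> : \sum_(c <- cs) (l (departure c x) - l (p c (departure c x))) =
    l x - l (pos p sigma cs x).
  rewrite /departure; elim/last_ind: (cs) ucs => [|r c IH]; first by rewrite big_nil /l hs subrr.
  rewrite rcons_uniq => /andP[cr /IH{}IH].
  rewrite -cats1 big_cat big_seq1 /= -[X in X + _](_ : \sum_(i <- r)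
      (l (pos p sigma (take (index i r) r) x) - l (p i (pos p sigma (take (index i r) r) x))) = _).
    rewrite IH cats1 pos_rcons -cats1 index_cat (negbTE cr) /= eqxx addn0 take_size_cat //.
    by rewrite /l hs; ring.
  rewrite big_seq [RHS]big_seq; apply: eq_bigr => i ir.
  by rewrite index_cat ir takel_cat // index_size.
have pick u : \sum_y (y == u)%:R * (h (lshift t y) - h (rshift s (tau y))) =
    l u - h (rshift s (tau u)).
  by rewrite (bigD1 u) //= eqxx mul1r big1 ?addr0 // => y /negbTE->; rewrite mul0r.
under [X in _ + X]eq_bigr do rewrite mulrBl.
rewrite sumrB !pick; ring.
Qed.

(** Every position is an injective function of [x]: a coloured edge serves one walk, a terminal edge
    one start and one end. *)
Lemma route_load (e : edge) : \sum_x `|route x e| <= 2.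
Proof.
have one (f : 'I_s -> 'I_s) y : injective f -> \sum_x ((y == f x)%:R : R) <= 1.
  move=> f_inj; have [x /eqP fx|none] := pickP (fun x => y == f x); last first.
    by rewrite big1 // => x _; rewrite none.
  rewrite (bigD1 x) //= fx eqxx big1 ?addr0 // => x' ne.
  by rewrite (inj_eq f_inj) eq_sym (negbTE ne).
case: e => [[c y]|y] /=.
  apply: (@le_trans _ _ (\sum_x (y == departure c x)%:R)).
    apply: ler_sum => x _; rewrite normr_nat ler_nat.
    by case: (y == _); case: (c \in cs); case: (_ != _).
  by apply: (le_trans (one _ _ _)); [exact: pos_inj | rewrite ler1n].
apply: (@le_trans _ _ (\sum_x ((y == pos p sigma cs x)%:R + (y == x)%:R))).
  by apply: ler_sum => x _; apply: (le_trans (ler_normB _ _)); rewrite !normr_nat.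
rewrite big_split -[leRHS]/(1 + 1) lerD ?one //; exact: pos_inj.
Qed.

Lemma congH_route (P : {set {set 'I_(s + t)}}) : finset.partition P [set: 'I_(s + t)] ->
  (forall x, finset.pblock P (lshift t (sigma x)) = finset.pblock P (lshift t x)) ->
  (congH gends (fun=> 1%R) P terminals
    (unit_demand R (fun x => rshift s (tau x))
      (fun x => rshift s (tau (pos p sigma cs x)))) <= 2%:E)%E.
Proof.
move=> partP Psigma.
have mem_T j : rshift s j \in terminals by apply: imset_f.
apply: (congH_le partP (fun _ => mem_T _) (fun _ => mem_T _)
  (phi := fun x e => route x (enum_val e))) => //.
- move=> x X XP; rewrite big_mkcond /=.
  transitivity (\sum_v (v \in X)%:R * netflow gends (fun e => route x (enum_val e)) v).
    by apply: eq_bigr => v _; rewrite mulr_natl mulrb.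
  rewrite (sum_netflow gends _ (fun v => (v \in X)%:R)).
  rewrite (@sum_route x (fun v => (v \in X)%:R)) // => y.
  by rewrite -!(eq_pblock_in partP) // Psigma.
by move=> e; rewrite mulr1 route_load.
Qed.
End Upper.
End Construction.

Lemma contraction_lower_bound (R : realType) (s t rho M b Pmax : nat) :
  let fx := ((100 * rho).+1 ^ (3 * M.*2.+1))%N in
  (0 < rho)%N -> (8 * rho <= M)%N -> (0 < b <= M)%N -> (M.*2 <= rho.+1 * b)%N ->
  (100 * rho * fx <= s)%N -> (100 * (Pmax * (100 * rho).+1 ^ b) <= s)%N ->
  (s + (50 * rho) ^ rho * (100 * rho * fx) <= t * (50 * rho) ^ rho)%N ->
  exists (m : nat) (ends : 'I_m -> 'I_(s + t) * 'I_(s + t)) (cap : 'I_m -> R)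
    (T : {set 'I_(s + t)}),
  [/\ forall e, (ends e).1 != (ends e).2, forall e, 1 <= cap e, #|T| = t &
    forall P : {set {set 'I_(s + t)}}, valid_partition P T -> (#|P| <= Pmax)%N ->
      exists D : 'I_(s + t) -> 'I_(s + t) -> R,
      [/\ is_demand T D, ((M%:R / (832 * rho%:R))%:E <= congG ends cap T D)%E
        & (congH ends cap P T D <= 2%:E)%E]].
Proof.
move=> fx rho0 rM bM Mb fxs Ps st.
have s0 : (0 < s)%N by apply: leq_trans fxs; rewrite !muln_gt0 rho0 /fx expn_gt0.
(* The Boolean serves [alternate], leaving [50 * rho] choices per step out of a degree of
   [100 * rho]. *)
set C := (bool * 'I_(50 * rho))%type.
have cardC : #|{: C}| = (100 * rho)%N by rewrite card_prod card_bool card_ord mulnA.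
have [p [pK gg fixed]] := exists_girth_gt 'I_s C (3 * M.*2.+1).
rewrite cardC in fixed.
have rg : (2 * rho <= 3 * M.*2.+1)%N by lia.
have [Z [z [zZ z_near Zle]]] := exists_centers pK gg rg.
have {}Zle : (#|Z| <= t)%N.
  rewrite -(@leq_pmul2r ((50 * rho) ^ rho)) ?expn_gt0 ?muln_gt0 ?rho0 //.
  apply: leq_trans st; apply: (leq_trans Zle); rewrite card_ord leq_add2l leq_mul2l.
  apply/orP; right; rewrite -cardC -sum_nat_const.
  apply: (@leq_trans (\sum_(c : C) #|[set x | p c x == x]|)); last exact: leq_sum.
  under eq_bigr do rewrite -sum1_card big_mkcond.
  rewrite exchange_big -sum1_card big_mkcond leq_sum // => x _ /=.
  rewrite inE; case: existsP => // -[c fix_c].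
  by rewrite (bigD1 c) //= inE fix_c.
pose x0 := Ordinal s0.
have idx x : (index (z x) (enum Z) < t)%N.
  by apply: leq_trans Zle; rewrite cardE index_mem mem_enum.
pose tau x := Ordinal (idx x); pose cent (j : 'I_t) := nth x0 (enum Z) j.
have tau_near x : cent (tau x) \in cball p (2 * rho) x.
  by rewrite /cent /= nth_index ?mem_enum.
exists #|edge s C|, (gends p tau), (fun=> 1), (terminals s t).
split; [exact: gends_neq | by [] | exact: card_terminals |].
move=> P [partP _] Pcard.
have [|||||sigma [cs [Fsigma ucs far]]] := @exists_route 'I_s C _
  (fun x => finset.pblock P (lshift t x)) p _ M b rho fx pK gg (leqnn _) bM _ fixed.
- by rewrite cardC; lia.
- by rewrite card_ord mulnA.
- by rewrite cardC; lia.
- by [].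
- rewrite cardC card_ord; apply: leq_trans Ps; rewrite leq_mul2l leq_mul2r.
  apply/orP; right; apply/orP; right; apply: leq_trans Pcard; apply: subset_leq_card.
  by apply/fintype.subsetP => _ /imsetP[x _ ->]; apply: pblock_in partP _.
rewrite card_ord in far.
set N := M.*2.+1 in far; set Phi := pos p sigma cs in far.
have r4M : (4 * rho <= M)%N by lia.
pose a x := rshift s (tau x); pose b' x := rshift s (tau (Phi x)).
exists (unit_demand R a b'); split; last exact: congH_route.
  split; first by move=> u v; apply: sumr_ge0 => i _; rewrite addr_ge0.
  have [x]: exists x, (M <= tdist p N x (Phi x))%N.
    have : (0 < #|[set x | M <= tdist p N x (Phi x)]%N|)%N by lia.
    by case/card_gt0P => x; rewrite inE; exists x.
  (* A common terminal would put [x] and [Phi x] within [4 * rho < M], so the demand is not zero. *)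
  move=> Mx; have ab : a x != b' x.
    apply: contraTneq Mx => /rshift_inj e; rewrite -ltnNge.
    have h := tdist_triangle pK N x (cent (tau x)) (Phi x).
    have port y : (tdist p N y (cent (tau y)) <= 2 * rho)%N.
      by rewrite tdist_le // tau_near orbT.
    have h1 := port x; have h2 := port (Phi x).
    rewrite (tdist_sym pK) -e in h2; lia.
  have mem_T j : rshift s j \in terminals s t by apply: imset_f.
  have pos_dem u v : (u = a x /\ v = b' x) \/ (u = b' x /\ v = a x) ->
      unit_demand R a b' u v != 0.
    move=> uv; apply: lt0r_neq0; rewrite /unit_demand (bigD1 x) //= ltr_wpDr //.
      by apply: sumr_ge0 => i _; rewrite addr_ge0.
    by case: uv => -[-> ->]; rewrite eqxx; [apply: ltr_wpDr | apply: ltr_wpDl].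
  have [lt|gt|/val_inj e] := ltngtP (a x) (b' x); last by rewrite e eqxx in ab.
    by exists (a x), (b' x); split; [exact: mem_T | exact: mem_T | | apply: pos_dem; left].
  by exists (b' x), (a x); split; [exact: mem_T | exact: mem_T | | apply: pos_dem; right].
(* The volume per base vertex is [100 * rho] for colours, [2 * rho] for the replaced edges and
   [2 * rho] for the terminal edges. As [M - 4 * rho >= M / 2], the bound has denominator
   [4 * 2 * 104 = 832]. *)
apply: le_trans (congG_ge (vol := (104 * rho * s)%:R) pK tau_near fixed s0 r4M far _ _).
- rewrite lee_fin natrB // !natrM.
  have sR : (0 : R) < s%:R by rewrite ltr0n.
  have rR : (0 : R) < rho%:R by rewrite ltr0n.
  have MR : 8 * rho%:R <= M%:R :> R by rewrite -natrM ler_nat.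
  have -> : s%:R / 4 * (M%:R - 4 * rho%:R) / (104 * rho%:R * s%:R) =
      (2 * (M%:R - 4 * rho%:R)) / (832 * rho%:R) :> R.
    by field; rewrite !lt0r_neq0.
  have v0 : (0 : R) < 832 * rho%:R by apply: mulr_gt0 rR; rewrite ltr0n.
  apply: ler_wpM2r; first by rewrite invr_ge0 ltW.
  clear -MR; lra.
- by rewrite ltr0n !muln_gt0 rho0 s0.
rewrite ler_nat cardC; nia.
Qed.

(** * Numerical estimates *)
(** [b] is the length required of a jump: half of [rho.+1] such jumps cover [M]. *)
Lemma ceil_quotient_bounds (rho M : nat) : (4 <= rho)%N -> (8 * rho <= M)%N ->
  let b := (M.*2 %/ rho).+1 in [/\ b <= M, M.*2 <= rho.+1 * b & b * rho <= M.*2 + rho]%N.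
Proof.
move=> rho4 rhoM /=; have rho0 : (0 < rho)%N by apply: leq_trans rho4.
have floor := leq_divM M.*2 rho; have ceil := ltn_ceil M.*2 rho0.
split; last by rewrite mulSn addnC leq_add2r.
  apply: (leq_ltn_trans (leq_div2l M.*2 _ rho4)) => //.
  by rewrite ltn_divLR // -addnn; move: rhoM rho4; clear; lia.
by rewrite mulnC; apply: (leq_trans (ltnW ceil)); rewrite leq_mul2l leqnSn orbT.
Qed.

Section Estimates.
Variable R : realType.
Local Notation e2 x := (2 `^ (x : R) : R).

Lemma pow2D (x z : R) : e2 (x + z) = e2 x * e2 z.
Proof. by rewrite powRD // pnatr_eq0 implybT. Qed.

Lemma ler_pow2 (x z : R) : x <= z -> e2 x <= e2 z.
Proof. by apply: ler_powR; rewrite ler1n. Qed.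

Lemma pow2_gt0 (x : R) : 0 < e2 x.
Proof. by rewrite powR_gt0. Qed.

Lemma pow2_half (x : R) : e2 (x - 1) + e2 (x - 1) = e2 x.
Proof.
by rewrite -[in RHS](subrK 1 x) (pow2D (x - 1)) powRr1 // mulr_natr mulr2n.
Qed.

Lemma pow2X (x : R) m : e2 x ^+ m = e2 (x * m%:R).
Proof. by rewrite powRrM powR_mulrn // powR_ge0. Qed.

Lemma trunc_bounds (x : R) : 0 <= x -> exists i : nat, i%:R <= x /\ x < i%:R + 1.
Proof.
move=> x0; exists (Num.truncn x); have /andP[h1 h2] := truncn_itv x0.
by split=> //; rewrite -natr1 in h2.
Qed.

(** With [y] the logarithm of [L], both the degree and the branching are powers of two with exponent
    of order [y]. So [rho * y] of order [A] fixes the number of terminals, and [M * y] of order [L]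
    the girth. *)
Lemma choose_rho_M (L A y : R) : 1 <= y -> y <= A -> 102 * (102 * A) <= L ->
  exists rho M : nat, [/\ (4 <= rho)%N, (8 * rho <= M)%N,
    4 * A <= rho%:R * y <= 8 * A & 80 * (M%:R * y) <= L <= 160 * (M%:R * y)].
Proof.
move=> y1 yA AL; have y0 : 0 < y by lra.
have A0 : 0 < A by lra.
have [r' [r'1 r'2]] : exists i : nat, i%:R <= 4 * A / y /\ 4 * A / y < i%:R + 1.
  by apply: trunc_bounds; rewrite divr_ge0 // ltW // mulr_gt0.
have [M [M1 M2]] : exists i : nat, i%:R <= L / (80 * y) /\ L / (80 * y) < i%:R + 1.
  by apply: trunc_bounds; rewrite divr_ge0 //; lra.
have y80 : 0 < 80 * y by lra.
rewrite ler_pdivlMr // in r'1; rewrite ltr_pdivrMr // in r'2.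
rewrite ler_pdivlMr // in M1; rewrite ltr_pdivrMr // in M2.
have ry1 : 4 * A <= r'.+1%:R * y by rewrite -natr1; lra.
have ry2 : r'.+1%:R * y <= 8 * A by rewrite -natr1; lra.
have m1 : 1 <= M%:R :> R.
  rewrite leNgt; apply/negP => m1; have : (M%:R + 1) * (80 * y) < 2 * (80 * y).
    by rewrite ltr_pM2r //; lra.
  by clear -M2 AL yA y1; lra.
have my0 : y <= M%:R * y by rewrite ler_peMl // ltW.
exists r'.+1, M; split.
- by rewrite -(ler_nat R) -(ler_pM2r y0); clear -ry1 yA; lra.
- rewrite -(ler_nat R) natrM -(ler_pM2r y0); clear -ry2 AL M2 my0 A0; lra.
- by rewrite ry1.
by apply/andP; split; clear -M1 M2 my0; lra.
Qed.

Lemma degree_bound (rho j : nat) (L y : R) : L = e2 y -> 1 <= y -> 102 <= L ->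
  rho%:R * y <= L -> ((100 * rho).+1 ^ j)%:R <= e2 (2 * y * j%:R).
Proof.
move=> Ly y1 L102 ry; have y0 : 0 < y by lra.
have D_le : (100 * rho).+1%:R <= e2 (2 * y).
  rewrite -natr1 natrM (_ : 2 * y = y + y); last by ring.
  have : rho%:R * 1 <= rho%:R * y by rewrite ler_wpM2l.
  have : 102 * L <= L * L by rewrite ler_pM2r //; lra.
  rewrite pow2D -Ly; lra.
by rewrite natrX -pow2X lerXn2r // nnegrE ?ler0n // ltW // pow2_gt0.
Qed.

(** The factor 80 gives [2 * y * 9 * M <= 18 / 80 * L], below [L / 4]. *)
Lemma stuck_bound (rho M : nat) (L y : R) : L = e2 y -> 1 <= y -> 102 * 102 <= L ->
  (4 <= rho)%N -> (8 * rho <= M)%N ->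
  rho%:R * y <= L -> 80 * (M%:R * y) <= L -> 16 * y <= L ->
  (100 * rho * (100 * rho).+1 ^ (3 * M.*2.+1))%:R <= e2 (L / 2).
Proof.
move=> Ly y1 L102 rho4 rhoM ry my yL; have y0 : 0 < y by lra.
have L102' : 102 <= L by lra.
apply: (@le_trans _ _ (e2 (2 * y) * e2 (L / 4))); last first.
  by rewrite -pow2D; apply: ler_pow2; lra.
rewrite natrM ler_pM ?ler0n //.
  have := @degree_bound rho 1 L y Ly y1 L102' ry; rewrite expn1 mulr1.
  by apply: le_trans; rewrite ler_nat.
apply: (le_trans (degree_bound _ Ly y1 L102' ry)); apply: ler_pow2.
have h : (3 * M.*2.+1 <= 9 * M)%N by move: rhoM rho4; clear; lia.
have {}h : (3 * M.*2.+1)%:R <= 9 * M%:R :> R by rewrite -natrM ler_nat.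
have : y * (3 * M.*2.+1)%:R <= y * (9 * M%:R) by rewrite ler_pM2l.
lra.
Qed.

(* Here [L = v ^+ 12], so that [v] is a power of [log2 n] against which all terms of the
   exponent can be compared. *)
Lemma jump_exponent_bound (rho M b : nat) (L A B v y : R) : L = v ^+ 12 ->
  0 < y -> y <= v ^+ 2 -> 24 <= v -> v ^+ 8 <= A -> v ^+ 8 <= B ->
  4 * A <= rho%:R * y -> 80 * (M%:R * y) <= L -> b%:R * rho%:R <= 2 * M%:R + rho%:R :> R ->
  (0 < b)%N -> v + 2 * y * b%:R <= B.
Proof.
move=> Lv y0 yv v24 vA vB ry my br b0.
have v1 : 1 <= v by lra.
have v0 i : 0 < v ^+ i by apply: exprn_gt0; lra.
have A0 : 0 < A by exact: lt_le_trans vA.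
have b1 : 0 <= b%:R - 1 :> R by rewrite subr_ge0 ler1n.
have hb : (b%:R - 1) * 160 <= v ^+ 4.
  rewrite -(ler_pM2r A0).
  have h1 : v ^+ 4 * v ^+ 8 <= v ^+ 4 * A by rewrite ler_pM2l.
  rewrite -exprD -Lv in h1.
  have h2 : b%:R * rho%:R * y <= (2 * M%:R + rho%:R) * y by rewrite ler_pM2r.
  have h3 : (b%:R - 1) * (4 * A) <= (b%:R - 1) * (rho%:R * y) by rewrite ler_wpM2l.
  clear -h1 h2 h3 my; lra.
have h2 : y * ((b%:R - 1) * 160) <= v ^+ 2 * v ^+ 4.
  by apply: ler_pM yv hb; [exact: ltW | apply: mulr_ge0 b1 _; rewrite ler0n].
have h3 : v ^+ 1 <= v ^+ 6 by apply: ler_weXn2l.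
have h4 : v ^+ 2 <= v ^+ 6 by apply: ler_weXn2l.
have h5 : 24 * 24 <= v ^+ 2 by rewrite expr2 ler_pM.
have h6 : v ^+ 6 * (24 * 24) <= v ^+ 6 * v ^+ 2 by rewrite ler_pM2l.
rewrite -exprD in h2; rewrite -exprD in h6; rewrite expr1 in h3; have h7 := v0 6%N.
clear -h2 h3 h4 h6 h7 vB yv; lra.
Qed.

(** In the exponent, [B] pays for the balls of radius [b], and the extra [v] absorbs the constant
    [200 * C]. *)
Lemma parts_bound (rho b Pmax : nat) (L B C v y z : R) : L = e2 y -> 1 <= y -> 102 <= L ->
  rho%:R * y <= L -> 0 < C -> 200 * C <= e2 v -> v + 2 * y * b%:R <= B ->
  Pmax%:R <= C * (e2 L / e2 B) -> e2 (L - 1) <= z ->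
  (100 * (Pmax * (100 * rho).+1 ^ b))%:R <= z.
Proof.
move=> Ly y1 L102 ry C0 Cv vB Q; apply: le_trans.
apply: (@le_trans _ _ (100 * (C * (e2 L / e2 B) * e2 (2 * y * b%:R)))).
  by rewrite natrM ler_wpM2l ?ler0n // natrM ler_pM ?ler0n // (degree_bound _ Ly).
rewrite -powRN -pow2D.
have h := mulr_gt0 (pow2_gt0 (L - B)) (pow2_gt0 (2 * y * b%:R)).
have le1 : 200 * C * (e2 (L - B) * e2 (2 * y * b%:R)) <=
    e2 v * (e2 (L - B) * e2 (2 * y * b%:R)) by rewrite ler_pM2r.
have le2 : e2 v * (e2 (L - B) * e2 (2 * y * b%:R)) <= e2 L.
  by rewrite -!pow2D; apply: ler_pow2; clear -vB; lra.
rewrite -[e2 L]pow2_half in le2; clear -le1 le2; lra.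
Qed.

(** Since [50 * rho] is at least the square root of [L], the power [H] is at least 2 to the
    [rho * y / 2], hence to the [A + 1], while [t] is about [n] divided by 2 to the [A]; the spare
    factor 2 covers [G] and the rounding of [t]. *)
Lemma terminals_bound (n t rho G : nat) (L A v y : R) : n%:R = e2 L -> L = v ^+ 12 ->
  L = e2 y -> 0 < y -> y <= v ^+ 2 -> 0 < v -> v ^+ 8 <= A -> 1 <= A -> 102 * A <= L ->
  4 * A <= rho%:R * y -> G%:R <= e2 (L / 2) -> n%:R / e2 A < t%:R + 1 ->
  (n - t + (50 * rho) ^ rho * G <= t * (50 * rho) ^ rho)%N.
Proof.
move=> nE Lv Ly y0 yv v0 vA A1 AL ry G_le t2.
set H := ((50 * rho) ^ rho)%N.
have H_ge : e2 (A + 1) <= H%:R.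
  have sq : e2 (y / 2) <= (50 * rho)%:R.
    have -> : e2 (y / 2) = v ^+ 6.
      apply/eqP; rewrite -(@eqrXn2 _ 2) ?ltW ?pow2_gt0 ?exprn_gt0 // pow2X -exprM /= -Lv Ly.
      by rewrite mulfVK // pnatr_eq0.
    rewrite natrM -(ler_pM2r y0).
    have h1 : v ^+ 6 * y <= v ^+ 6 * v ^+ 2 by rewrite ler_pM2l ?exprn_gt0.
    rewrite -exprD in h1; clear -h1 vA ry A1; lra.
  apply: (@le_trans _ _ (e2 (y / 2) ^+ rho)).
    by rewrite pow2X; apply: ler_pow2; clear -ry A1; lra.
  by rewrite /H natrX lerXn2r // nnegrE ?ler0n // ltW // pow2_gt0.
rewrite -(ler_nat R) natrD !natrM.
have Gt : e2 (L - A - 1) <= t%:R - G%:R.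
  rewrite nE -powRN -pow2D -[e2 (L - A)]pow2_half in t2.
  have e3 : e2 (L / 2) + 1 <= e2 (L - A - 1).
    apply: (@le_trans _ _ (e2 (L / 2 + 1))); last by apply: ler_pow2; clear -AL A1; lra.
    rewrite (pow2D _ 1) powRr1 //.
    have : e2 0 <= e2 (L / 2) by apply: ler_pow2; clear -AL A1; lra.
    rewrite powRr0; clear; lra.
  clear -e3 t2 G_le; lra.
have s_le : (n - t)%:R <= e2 (L - A - 1) * e2 (A + 1).
  rewrite -pow2D (_ : _ + _ = L); last by ring.
  by rewrite -nE ler_nat leq_subr.
have : e2 (L - A - 1) * e2 (A + 1) <= (t%:R - G%:R) * H%:R.
  by rewrite ler_pM // ltW // pow2_gt0.
clear -s_le; lra.
Qed.

(** [L], [y], [A], [B] stand for $\log n$, $\log\log n$, $(\log n)^\alpha$, $(\log n)^\beta$; the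
    two exponents enter through [A] and [B] being at least [v ^+ 8], where [8 / 12 = 2 / 3]. *)
Lemma choose_parameters (n : nat) (L A B C v y : R) :
  n%:R = e2 L -> L = v ^+ 12 -> L = e2 y -> 1 <= y -> y <= v ^+ 2 -> 24 <= v ->
  v ^+ 8 <= A -> 102 * (102 * A) <= L -> v ^+ 8 <= B -> 0 < C -> 200 * C <= e2 v ->
  exists t rho M b Pmax : nat,
  let fx := ((100 * rho).+1 ^ (3 * M.*2.+1))%N in let s := (n - t)%N in
  [/\ [/\ (t <= n)%N, n%:R / e2 A - 1 < t%:R, t%:R <= n%:R / e2 A,
        forall x : nat, x%:R <= C * (n%:R / e2 B) -> (x <= Pmax)%N
      & L / (160 * (832 * (8 * A))) <= M%:R / (832 * rho%:R)],
    [/\ (0 < rho)%N, (8 * rho <= M)%N, (0 < b <= M)%N & (M.*2 <= rho.+1 * b)%N],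
    (100 * rho * fx <= s)%N, (100 * (Pmax * (100 * rho).+1 ^ b) <= s)%N &
    (s + (50 * rho) ^ rho * (100 * rho * fx) <= t * (50 * rho) ^ rho)%N].
Proof.
move=> nE Lv Ly y1 yv v24 vA AL vB C0 Cv.
have v1 : 1 <= v by lra.
have v0 i : 0 < v ^+ i by apply: exprn_gt0; lra.
have yA : y <= A by apply: (le_trans yv); apply: le_trans vA; apply: ler_weXn2l.
have A1 : 1 <= A by exact: le_trans yA.
have A0 : 0 < A by exact: lt_le_trans A1.
have y0 : 0 < y by exact: lt_le_trans y1.
have L102 : 102 * 102 <= L by clear -AL A1; lra.
have L102' : 102 <= L by clear -L102; lra.
have [rho [M [rho4 rhoM /andP[ry1 ry2] /andP[my1 my2]]]] := choose_rho_M y1 yA AL.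
have ry : rho%:R * y <= L by clear -ry2 AL A0; lra.
have [bM Mb brN] := ceil_quotient_bounds rho4 rhoM; set b := (_ %/ _).+1 in bM Mb brN.
have br : b%:R * rho%:R <= 2 * M%:R + rho%:R :> R.
  by rewrite -!natrM -natrD ler_nat mul2n.
have nA : n%:R / e2 A = e2 (L - A) by rewrite nE -powRN -pow2D.
have [t [t1 t2]] : exists i : nat, i%:R <= n%:R / e2 A /\ n%:R / e2 A < i%:R + 1.
  by apply: trunc_bounds; rewrite nA ltW // pow2_gt0.
have [Pmax [Q1 Q2]] : exists i : nat, i%:R <= C * (n%:R / e2 B) /\ C * (n%:R / e2 B) < i%:R + 1.
  by apply: trunc_bounds; rewrite nE ltW // mulr_gt0 // divr_gt0 // pow2_gt0.
have half : e2 (L - 1) + e2 (L - 1) = n%:R by rewrite nE pow2_half.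
have t_le : t%:R <= e2 (L - 1).
  by apply: (le_trans t1); rewrite nA; apply: ler_pow2; clear -A1; lra.
have tn : (t <= n)%N.
  rewrite -(ler_nat R) -half; have h := pow2_gt0 (L - 1); clear -h t_le; lra.
have s_ge : e2 (L - 1) <= (n - t)%:R by rewrite natrB // -half; clear -t_le; lra.
have G_le : (100 * rho * (100 * rho).+1 ^ (3 * M.*2.+1))%:R <= e2 (L / 2).
  by apply: (stuck_bound Ly) => //; clear -AL yA A0; lra.
exists t, rho, M, b, Pmax; split.
- split=> //; first by clear -t2; lra.
    by move=> x /le_lt_trans/(_ Q2); rewrite natr1 ltr_nat ltnS; exact.
  have r0 : 0 < rho%:R :> R by rewrite ltr0n; apply: leq_trans rho4.
  have c0 : 0 < 160 * (832 * (8 * A)) by do 3!(apply: mulr_gt0; first by rewrite ltr0n).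
  have c1 : 0 < 832 * rho%:R :> R by apply: mulr_gt0; first by rewrite ltr0n.
  rewrite ler_pdivrMr // mulrAC ler_pdivlMr //.
  have h1 : L * rho%:R <= 160 * (M%:R * y) * rho%:R by rewrite ler_pM2r.
  have h2 : M%:R * (rho%:R * y) <= M%:R * (8 * A) by rewrite ler_wpM2l.
  by clear -h1 h2; lra.
- by split=> //; apply: leq_trans rho4.
- rewrite -(ler_nat R); apply: (le_trans G_le); apply: le_trans s_ge.
  by apply: ler_pow2; clear -L102; lra.
- rewrite -(ler_nat R); rewrite nE in Q1.
  apply: (parts_bound Ly y1 L102' ry C0 Cv _ Q1 s_ge).
  exact: (jump_exponent_bound Lv y0 yv v24 vA vB ry1 my1 br).
apply: (terminals_bound nE Lv Ly y0 yv _ vA A1 _ ry1 G_le t2); first by clear -v1; lra.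
by clear -AL A0; lra.
Qed.
End Estimates.

(** * The exponents and the threshold for large [n] *)

Section Exponents.
Variable R : realType.

Lemma ln2_gt0 : 0 < ln (2 : R).
Proof. by rewrite ln_gt0 // ltr1n. Qed.

Lemma ln2_ge : 1 / 2 <= ln (2 : R).
Proof.
have h : -1 < - (1 / 2) :> R by lra.
have := le_ln1Dx h; rewrite (_ : 1 + - (1 / 2) = 2^-1 :> R); last by field.
rewrite lnV ?posrE ?ltr0n //; lra.
Qed.

Lemma log2_5_ge : 2 <= log2 (5 : R).
Proof.
rewrite /log2 ler_pdivlMr ?ln2_gt0 // mulr_natl -lnXn ?ltr0n // ler_ln ?posrE ?exprn_gt0 //.
by rewrite expr2; lra.
Qed.

Lemma alpha_bounds (eps : R) : 0 < eps < 1 -> 2 / 3 <= alpha eps < 1.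
Proof.
move=> /andP[e0 e1]; have l5 := log2_5_ge; rewrite /alpha.
have d0 : 0 < log2 5 + 1 - eps by lra.
by rewrite ler_pdivlMr // ltr_pdivrMr //; apply/andP; split; lra.
Qed.

Lemma beta_ge (eps : R) : 0 < eps < 1 -> 2 / 3 <= beta eps.
Proof.
move=> /andP[e0 e1]; have l5 := log2_5_ge; rewrite /beta.
have d0 : 0 < log2 5 + 1 - eps by lra.
by rewrite ler_pdivlMr //; lra.
Qed.

Lemma pow2_log2 (x : R) : 0 < x -> 2 `^ log2 x = x.
Proof.
move=> x0; rewrite /powR pnatr_eq0 /= /log2 mulfVK ?lt0r_neq0 ?ln2_gt0 //.
by rewrite lnK.
Qed.

Lemma log2_ge (x z : R) : 2 `^ z <= x -> z <= log2 x.
Proof.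
move=> le; have x0 := lt_le_trans (pow2_gt0 z) le.
rewrite /log2 ler_pdivlMr ?ln2_gt0 // -ln_powR ler_ln // posrE //; exact: pow2_gt0.
Qed.

Lemma eventually_large (a b C : R) : 2 / 3 <= a < 1 -> 2 / 3 <= b -> 0 < C ->
  exists L0 : R, forall L : R, L0 <= L -> exists v y : R,
  [/\ L = v ^+ 12, L = 2 `^ y, 1 <= y <= v ^+ 2 & 24 <= v] /\
  [/\ v ^+ 8 <= L `^ a, 102 * (102 * L `^ a) <= L, v ^+ 8 <= L `^ b & 200 * C <= 2 `^ v].
Proof.
move=> /andP[a1 a2] b1 C0.
pose v0 := 24 + `|log2 (200 * C)|.
have v024 : 24 <= v0 by rewrite lerDl.
(* The first threshold forces [v0 <= v]; the second makes [102 * 102] at most [L] to the power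
   [1 - a]. *)
exists (Num.max (v0 ^+ 12) ((102 * 102) `^ (1 - a)^-1)) => L.
rewrite ge_max => /andP[Lv0 La].
have L0 : 0 < L by apply: lt_le_trans Lv0; apply: exprn_gt0; lra.
have a0 : 0 < 1 - a by lra.
pose v := L `^ 12^-1.
have v_ge0 : 0 <= v by apply: powR_ge0.
have Lv : L = v ^+ 12.
  by rewrite -powR_mulrn // -powRrM mulVf ?pnatr_eq0 // powRr1 // ltW.
have vv : v0 <= v.
  by rewrite -(@ler_pXn2r _ 12) -?Lv // nnegrE; lra.
have v24 : 24 <= v by lra.
have v1 : 1 <= v by lra.
have L2 : v <= L by rewrite {1}Lv -[leLHS]expr1 ler_weXn2l.
have L1 : 1 <= L by exact: le_trans L2.
have pow8 e : 2 / 3 <= e -> v ^+ 8 <= L `^ e.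
  move=> e23; rewrite -powR_mulrn // -powRrM; apply: ler_powR => //; lra.
exists v, (log2 L); split; split=> //.
- by rewrite pow2_log2.
- apply/andP; split; first by apply: log2_ge; rewrite powRr1 //; lra.
  (* From [ln v <= v - 1] and [ln 2 >= 1 / 2], [y] is at most [24 * v], hence at most [v ^+ 2]. *)
  rewrite /log2 ler_pdivrMr ?ln2_gt0 // Lv lnXn; last by lra.
  have h : -1 < v - 1 by lra.
  have := le_ln1Dx h; rewrite addrC subrK => lnv.
  have h2 : v ^+ 2 * (1 / 2) <= v ^+ 2 * ln 2 by rewrite ler_wpM2l ?exprn_ge0 // ln2_ge.
  apply: le_trans h2; rewrite -mulr_natl expr2.
  have : 24 * v <= v * v by rewrite ler_pM2r //; lra.
  by clear -lnv v24; lra.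
- by apply: pow8.
- have aa : L `^ a * L `^ (1 - a) = L.
    rewrite -powRD; last by rewrite lt0r_neq0 ?implybT.
    by rewrite addrC subrK powRr1 // ltW.
  have : 102 * 102 <= L `^ (1 - a).
    have c_ge0 : 0 <= 102 * 102 :> R by apply: mulr_ge0; rewrite ler0n.
    have -> : 102 * 102 = ((102 * 102) `^ (1 - a)^-1) `^ (1 - a) :> R.
      by rewrite -powRrM mulVf ?lt0r_neq0 // powRr1.
    apply: ge0_ler_powR La.
    + exact: ltW.
    + by rewrite nnegrE powR_ge0.
    + by rewrite nnegrE ltW.
  have La0 : 0 < L `^ a by rewrite powR_gt0.
  by rewrite -(ler_pM2l La0) aa; clear; lra.
- exact: pow8.
have C200 : 0 < 200 * C by apply: mulr_gt0 => //; rewrite ltr0n.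
rewrite -[leLHS]pow2_log2 //; apply: ler_pow2.
apply: le_trans vv; rewrite /v0; have := ler_norm (log2 (200 * C)); lra.
Qed.
End Exponents.

Unset Implicit Arguments.

Theorem theorem3p1 (R : realType) :
  exists eps0 : R, 0 < eps0 /\
  forall eps : R, 0 < eps < eps0 ->
  forall C : R, 0 < C ->
  exists c C' : R, 0 < c /\ 0 < C' /\
  exists N : nat, forall n : nat, (N <= n)%N ->
  exists (m : nat) (ends : 'I_m -> 'I_n * 'I_n) (cap : 'I_m -> R) (T : {set 'I_n}),
    [/\ (forall e, (ends e).1 != (ends e).2),
        (forall e, 1 <= cap e),
        n%:R / 2 `^ (log2 n%:R `^ alpha eps) - 1 < #|T|%:R,
        #|T|%:R <= n%:R / 2 `^ (log2 n%:R `^ alpha eps) &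
        forall P : {set {set 'I_n}},
          valid_partition P T ->
          #|P|%:R <= C * (n%:R / 2 `^ (log2 n%:R `^ beta eps)) ->
          exists D : 'I_n -> 'I_n -> R,
            [/\ is_demand T D,
                ((c * log2 n%:R `^ (1 - alpha eps))%:E <= congG ends cap T D)%E &
                (congH ends cap P T D <= C'%:E)%E]].
Proof.
(* For [eps < 1], the estimate [log2 5 >= 2] already places [alpha] in [[2/3, 1)] and [beta] above
   [2/3]. *)
exists 1; split=> // eps eps01 C C0.
have a_bounds := alpha_bounds eps01; have b_ge := beta_ge eps01.
have [L0 large] := eventually_large a_bounds b_ge C0.
have [N [_ N2]] := @trunc_bounds R (2 `^ L0) (ltW (pow2_gt0 L0)).
(* The factors come from [L <= 160 * (M * y)], the bound [M / (832 * rho)], and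
   [rho * y <= 8 * A]. *)
exists (160 * (832 * 8))^-1, 2; split.
  by rewrite invr_gt0; apply: mulr_gt0; [|apply: mulr_gt0]; rewrite ltr0n.
split; first by rewrite ltr0n.
exists N.+1 => n Nn; set L := log2 n%:R.
have n_ge : 2 `^ L0 <= n%:R.
  by apply: (le_trans (ltW N2)); rewrite natr1 ler_nat.
have nE : n%:R = 2 `^ L by rewrite pow2_log2 // (lt_le_trans (pow2_gt0 L0)).
have [v [y [[Lv Ly /andP[y1 yv] v24] [vA AL vB Cv]]]] := large L (log2_ge n_ge).
have [t [rho [M [b [Pmax [[tn t1 t2 PmaxE gap] [rho0 rM bM Mb] fxs Ps st]]]]]] :=
  choose_parameters nE Lv Ly y1 yv v24 vA AL vB C0 Cv.
have := contraction_lower_bound R rho0 rM bM Mb fxs Ps st; rewrite (subnK tn).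
move=> [m [ends [cap [T [ends_neq cap1 cardT H]]]]].
exists m, ends, cap, T; split=> //; rewrite ?cardT // => P validP Pcard.
have [D [demD lower upper]] := H P validP (PmaxE _ Pcard).
exists D; split=> //; apply: le_trans lower; rewrite lee_fin; apply: le_trans gap.
have L_gt0 : 0 < L by rewrite Lv exprn_gt0 //; lra.
rewrite powRB ?(lt0r_neq0 L_gt0) ?implybT // powRr1 ?(ltW L_gt0) //.
have := powR_gt0 (alpha eps) L_gt0; set A := L `^ _ => A0.
rewrite [leLHS](_ : _ = L / (160 * (832 * (8 * A)))); first exact: lexx.
by field; rewrite lt0r_neq0.
Qed.
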